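(* Let $G$ be a countably piecewise hyperdefinable group with a global logic topology. Then $G$ with its global logic topology is a topological group.
   Context: Fix a first-order many-sorted language $\mathcal{L}$ and a $\kappa$-saturated, strongly $\kappa$-homogeneous $\mathcal{L}$-structure $\mathfrak{M}$, with $\kappa>|\mathcal{L}|$ a strong limit cardinal; ''small'' means of cardinality $<\kappa$. A hyperdefinable set is a quotient $P=X/E$ of a nonempty type-definable set $X$ by a type-definable equivalence relation $E$. Parameter sets $A$ are small sets of hyperimaginaries; $P$ is $A$-hyperdefinable if $X,E$ are $\mathrm{Aut}(\mathfrak{M}/A)$-invariant; a subset of $P$ is $\bigwedge_A$-definable if its preimage in $X$ is type-definable and $\mathrm{Aut}(\mathfrak{M}/A)$-invariant. A piecewise $A$-hyperdefinable set is a direct limit $P=\varinjlim_{i\in I}P_i$ of a directed system of $A$-hyperdefinable sets with injective $\bigwedge_A$-definable transition maps, $\mathrm{cf}(I)<\kappa$; it is countably piecewise hyperdefinable if $I$ has countable cofinality. $V\subseteq P$ is piecewise $\bigwedge_A$-definable if each $V\cap P_i$ is $\bigwedge_A$-definable. The $A$-logic topology has as closed sets the piecewise $\bigwedge_A$-definable sets. At most one logic topology is $T_1$ (if the $A$-logic topology is $T_1$ it equals the $A'$-logic topology for every small $A'\supseteq A$); it is called the global logic topology, when it exists. A piecewise hyperdefinable group is a group whose universe is piecewise $A$-hyperdefinable (some small $A$) and whose operations are piecewise bounded (pieces map into pieces) with piecewise $\bigwedge_A$-definable graphs (products being $\varinjlim P_i\times Q_j$). Topological groups are assumed Hausdorff.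 *)

(* Defs.v *)
From mathcomp Require Import all_boot all_classical topology.

Set Implicit Arguments.
Unset Strict Implicit.
Unset Printing Implicit Defensive.

Local Open Scope classical_set_scope.
Local Open Scope card_scope.

Record language := Language {
  lsort : Type;
  func : Type;
  farity : func -> nat;
  fdom : forall f : func, 'I_(farity f) -> lsort;
  fcod : func -> lsort;
  rel_symb : Type;
  rarity : rel_symb -> nat;
  rdom : forall r : rel_symb, 'I_(rarity r) -> lsort }.

Arguments fdom {l f} _.
Arguments rdom {l r} _.

(* A context is a type [V] of variables with their sorts [V -> lsort L];
   [ext_sort s sg] adds one variable, [None], of sort [s]. *)
Definition ext_sort (S V : Type) (s : S) (sg : V -> S) (o : option V) : S :=
  if o is Some v then sg v else s.

Definition sum_sort (S V W : Type) (sg : V -> S) (tg : W -> S) (z : V + W) : S :=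
  match z with inl v => sg v | inr w => tg w end.

Inductive term (L : language) (V : Type) (sg : V -> lsort L) : lsort L -> Type :=
| Var (v : V) : term sg (sg v)
| App (f : func L) (t : forall i : 'I_(farity f), term sg (fdom i)) :
    term sg (fcod f).

Inductive formula (L : language) (V : Type) (sg : V -> lsort L) : Type :=
| Bot
| Equal (s : lsort L) (t u : term sg s)
| Rel (r : rel_symb L) (t : forall i : 'I_(rarity r), term sg (rdom i))
| Imp (phi psi : formula sg)
| All (s : lsort L) (phi : formula (ext_sort s sg)).

Record structure (L : language) := Structure {
  carrier :> lsort L -> Type;
  carrier_inh : forall s, inhabited (carrier s);
  fint : forall f : func L,
    (forall i : 'I_(farity f), carrier (fdom i)) -> carrier (fcod f);
  rint : forall r : rel_symb L,
    (forall i : 'I_(rarity r), carrier (rdom i)) -> Prop }.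

Definition tup (L : language) (M : structure L) (V : Type) (sg : V -> lsort L) :=
  forall v, M (sg v).

Definition ext_tup (L : language) (M : structure L) (V : Type)
    (sg : V -> lsort L) (s : lsort L) (a : M s) (x : tup M sg) :
    tup M (ext_sort s sg) :=
  fun o => match o return M (ext_sort s sg o) with
           | Some v => x v | None => a end.

Definition join_tup (L : language) (M : structure L) (V W : Type)
    (sg : V -> lsort L) (tg : W -> lsort L) (x : tup M sg) (y : tup M tg) :
    tup M (sum_sort sg tg) :=
  fun z => match z return M (sum_sort sg tg z) with
           | inl v => x v | inr w => y w end.

Definition ltup (L : language) (M : structure L) (V W : Type)
    (sg : V -> lsort L) (tg : W -> lsort L) (z : tup M (sum_sort sg tg)) :
    tup M sg := fun v => z (inl v).

Definition rtup (L : language) (M : structure L) (V W : Type)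
    (sg : V -> lsort L) (tg : W -> lsort L) (z : tup M (sum_sort sg tg)) :
    tup M tg := fun w => z (inr w).

Fixpoint teval (L : language) (M : structure L) (V : Type) (sg : V -> lsort L)
    (s : lsort L) (t : term sg s) (x : tup M sg) {struct t} : M s :=
  match t in term _ s return M s with
  | Var v => x v
  | App f t => fint (fun i => teval (t i) x)
  end.

Fixpoint sat (L : language) (M : structure L) (V : Type) (sg : V -> lsort L)
    (phi : formula sg) {struct phi} : tup M sg -> Prop :=
  match phi with
  | Bot => fun _ => False
  | Equal s t u => fun x => teval t x = teval u x
  | Rel r t => fun x => rint (fun i => teval (t i) x)
  | Imp phi psi => fun x => sat phi x -> sat psi x
  | All s phi => fun x => forall a : M s, sat phi (ext_tup a x)
  end.

Record automorphism (L : language) (M : structure L) := Automorphism {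
  aut :> forall s, M s -> M s;
  aut_bij : forall s, bijective (@aut s);
  aut_fint : forall (f : func L) (a : forall i : 'I_(farity f), M (fdom i)),
    aut (fint a) = fint (fun i => aut (a i));
  aut_rint : forall (r : rel_symb L) (a : forall i : 'I_(rarity r), M (rdom i)),
    rint a <-> rint (fun i => aut (a i)) }.

Definition aut_tup (L : language) (M : structure L) (V : Type)
    (sg : V -> lsort L) (f : automorphism M) (x : tup M sg) : tup M sg :=
  fun v => f _ (x v).

(* The cardinal kappa is represented by a type [K] of that cardinality. *)

Definition small (K T : Type) (A : set T) :=
  A #<= [set: K] /\ ~ ([set: K] #<= A).

Definition strong_limit (K : Type) :=
  forall T : Type, small K [set: T] -> small K [set: set T].

(* |L| is the number of sorts and symbols plus aleph_0. *)
Definition language_small (K : Type) (L : language) :=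
  small K [set: lsort L + func L + rel_symb L + nat].

Definition saturated (K : Type) (L : language) (M : structure L) :=
  forall (B : Type) (sg : B -> lsort L) (b : tup M sg) (s : lsort L)
         (Sigma : set (formula (ext_sort s sg))),
    small K [set: B] ->
    (forall F, finite_set F -> F `<=` Sigma ->
       exists a : M s, forall phi, F phi -> sat phi (ext_tup a b)) ->
    exists a : M s, forall phi, Sigma phi -> sat phi (ext_tup a b).

Definition strongly_homogeneous (K : Type) (L : language) (M : structure L) :=
  forall (B : Type) (sg : B -> lsort L) (b c : tup M sg),
    small K [set: B] ->
    (forall phi : formula sg, sat phi b <-> sat phi c) ->
    exists f : automorphism M, aut_tup f b = c.

Definition type_definable (K : Type) (L : language) (M : structure L)
    (V : Type) (sg : V -> lsort L) (X : set (tup M sg)) :=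
  exists (B : Type) (tg : B -> lsort L) (b : tup M tg)
         (Sigma : set (formula (sum_sort sg tg))),
    small K [set: B] /\
    forall x, X x <-> (forall phi, Sigma phi -> sat phi (join_tup x b)).

Definition type_definable0 (L : language) (M : structure L)
    (V : Type) (sg : V -> lsort L) (X : set (tup M sg)) :=
  exists Sigma : set (formula sg),
    forall x, X x <-> (forall phi, Sigma phi -> sat phi x).

(* The hyperimaginary is the class of [hi_rep] modulo [hi_rel]. *)
Record hyperimaginary (L : language) (M : structure L) := Hyperimaginary {
  hi_idx : Type;
  hi_sort : hi_idx -> lsort L;
  hi_rel : tup M hi_sort -> tup M hi_sort -> Prop;
  hi_rep : tup M hi_sort }.

Arguments hi_sort {L M} _ _.
Arguments hi_rel {L M} _ _ _.
Arguments hi_rep {L M} _ _.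

Definition is_hyperimaginary (K : Type) (L : language) (M : structure L)
    (e : hyperimaginary M) :=
  [/\ small K [set: hi_idx e],
      (forall x, hi_rel e x x),
      (forall x y, hi_rel e x y -> hi_rel e y x),
      (forall x y z, hi_rel e x y -> hi_rel e y z -> hi_rel e x z) &
      type_definable0 [set z | hi_rel e (ltup z) (rtup z)]].

Record parameters (L : language) (M : structure L) := ParameterSet {
  par_idx : Type;
  par_elt : par_idx -> hyperimaginary M }.

Definition small_parameters (K : Type) (L : language) (M : structure L)
    (A : parameters M) :=
  small K [set: par_idx A] /\
  forall k : par_idx A, is_hyperimaginary K (par_elt k).

(* [f] belongs to Aut(M/A): it maps each class in [A] to itself. *)
Definition fixes (L : language) (M : structure L) (A : parameters M)
    (f : automorphism M) :=
  forall k : par_idx A,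
    hi_rel (par_elt k) (hi_rep (par_elt k)) (aut_tup f (hi_rep (par_elt k))).

Definition aut_invariant (L : language) (M : structure L) (A : parameters M)
    (V : Type) (sg : V -> lsort L) (X : set (tup M sg)) :=
  forall f : automorphism M, fixes A f -> forall x, X x -> X (aut_tup f x).

(* Presents [P] as a quotient [X / E]: [X] is [qdom], and [E] is the kernel of
   [qproj] on [X]. The values of [qproj] outside [X] are irrelevant. Tuples are
   indexed by arbitrary types, required to be small in [hyperdefinable]. *)
Record presentation (L : language) (M : structure L) (P : Type) := Presentation {
  idx : Type;
  idx_sort : idx -> lsort L;
  qdom : set (tup M idx_sort);
  qproj : tup M idx_sort -> P }.

Arguments idx_sort {L M P} _ _.
Arguments qdom {L M P} _ _.
Arguments qproj {L M P} _ _.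

Definition quotient_rel (L : language) (M : structure L) (P : Type)
    (h : presentation M P) :
    set (tup M (sum_sort (idx_sort h) (idx_sort h))) :=
  [set z | [/\ qdom h (ltup z), qdom h (rtup z) &
               qproj h (ltup z) = qproj h (rtup z)]].

Arguments quotient_rel {L M P} _ _.

Definition hyperdefinable (K : Type) (L : language) (M : structure L)
    (A : parameters M) (P : Type) (h : presentation M P) :=
  [/\ [/\ small K [set: idx h], qdom h !=set0 & qproj h @` qdom h = setT],
      type_definable K (qdom h) /\ aut_invariant A (qdom h) &
      type_definable K (quotient_rel h) /\ aut_invariant A (quotient_rel h)].

Definition bigwedge_definable (K : Type) (L : language) (M : structure L)
    (A : parameters M) (P : Type) (h : presentation M P) (V : set P) :=
  type_definable K (qdom h `&` qproj h @^-1` V) /\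
  aut_invariant A (qdom h `&` qproj h @^-1` V).

Definition prod_presentation (L : language) (M : structure L) (P Q : Type)
    (h : presentation M P) (k : presentation M Q) : presentation M (P * Q) :=
  {| idx_sort := sum_sort (idx_sort h) (idx_sort k);
     qdom := [set z | qdom h (ltup z) /\ qdom k (rtup z)];
     qproj := fun z => (qproj h (ltup z), qproj k (rtup z)) |}.

Definition graph (P Q : Type) (f : P -> Q) : set (P * Q) := [set p | f p.1 = p.2].

Definition directed (I : Type) (le : I -> I -> Prop) :=
  [/\ inhabited I,
      (forall i, le i i),
      (forall i j k, le i j -> le j k -> le i k) &
      forall i j, exists k, le i k /\ le j k].

Definition cofinal (I : Type) (le : I -> I -> Prop) (J : set I) :=
  forall i, exists2 j, J j & le i j.

(* A direct system with a cocone [pw_incl] into [P]. Since a direct limit is only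
   defined up to a unique bijection, it is not constructed: [is_direct_limit]
   says that [P] is one. *)
Record pw_presentation (L : language) (M : structure L) (P : Type) :=
  PwPresentation {
    pw_idx : Type;
    pw_le : pw_idx -> pw_idx -> Prop;
    piece : pw_idx -> Type;
    pw_pres : forall i, presentation M (piece i);
    pw_trans : forall i j, pw_le i j -> piece i -> piece j;
    pw_incl : forall i, piece i -> P }.

Arguments pw_le {L M P} _ _ _.
Arguments piece {L M P} _ _.
Arguments pw_pres {L M P p} _.
Arguments pw_trans {L M P p i j} _ _.
Arguments pw_incl {L M P p} _ _.

Definition is_direct_limit (L : language) (M : structure L) (P : Type)
    (D : pw_presentation M P) :=
  [/\ (forall p : P, exists i (x : piece D i), pw_incl i x = p),
      (forall i j (hij : pw_le D i j) (x : piece D i),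
         pw_incl j (pw_trans hij x) = pw_incl i x) &
      (forall i j (x : piece D i) (y : piece D j), pw_incl i x = pw_incl j y ->
         exists k (hik : pw_le D i k) (hjk : pw_le D j k), pw_trans hik x = pw_trans hjk y)].

Definition prod_pw (L : language) (M : structure L) (P Q : Type)
    (D : pw_presentation M P) (D' : pw_presentation M Q) :
    pw_presentation M (P * Q) :=
  {| pw_le := fun i j : pw_idx D * pw_idx D' => pw_le D i.1 j.1 /\ pw_le D' i.2 j.2;
     piece := fun i => (piece D i.1 * piece D' i.2)%type;
     pw_pres := fun i => prod_presentation (pw_pres i.1) (pw_pres i.2);
     pw_trans := fun i j hij x =>
       (pw_trans (proj1 hij) x.1, pw_trans (proj2 hij) x.2);
     pw_incl := fun i x => (pw_incl i.1 x.1, pw_incl i.2 x.2) |}.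

Definition pw_hyperdefinable (K : Type) (L : language) (M : structure L)
    (A : parameters M) (P : Type) (D : pw_presentation M P) :=
  [/\ directed (pw_le D),
      (exists J, cofinal (pw_le D) J /\ small K J),
      (forall i : pw_idx D, hyperdefinable K A (pw_pres i)),
      [/\ (forall (i : pw_idx D) (hii : pw_le D i i) x, pw_trans hii x = x),
          (forall (i j k : pw_idx D) (hij : pw_le D i j) (hjk : pw_le D j k)
                  (hik : pw_le D i k) x, pw_trans hjk (pw_trans hij x) = pw_trans hik x) &
          (forall (i j : pw_idx D) (hij : pw_le D i j), injective (pw_trans hij) /\
             bigwedge_definable K A (prod_presentation (pw_pres i) (pw_pres j))
               (graph (pw_trans hij)))] &
      is_direct_limit D].

Definition countable_cofinality (L : language) (M : structure L) (P : Type)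
    (D : pw_presentation M P) :=
  exists J, cofinal (pw_le D) J /\ countable J.

Definition pw_bigwedge_definable (K : Type) (L : language) (M : structure L)
    (A : parameters M) (P : Type) (D : pw_presentation M P) (V : set P) :=
  forall i : pw_idx D, bigwedge_definable K A (pw_pres i) (pw_incl i @^-1` V).

Definition pw_bounded (L : language) (M : structure L) (P Q : Type)
    (D : pw_presentation M P) (D' : pw_presentation M Q) (f : P -> Q) :=
  forall i : pw_idx D, exists j : pw_idx D',
    f @` range (pw_incl i) `<=` range (pw_incl j).

Definition mul_map (G : groupType) (p : G * G) : G := (p.1 * p.2)%g.
Definition inv_map (G : groupType) (x : G) : G := (x^-1)%g.

Definition pw_hyperdefinable_group (K : Type) (L : language) (M : structure L)
    (G : groupType) (D : pw_presentation M G) :=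
  exists A : parameters M,
    [/\ small_parameters K A,
        pw_hyperdefinable K A D,
        pw_bounded (prod_pw D D) D (@mul_map G) /\
        pw_bigwedge_definable K A (prod_pw (prod_pw D D) D) (graph (@mul_map G)) &
        pw_bounded D D (@inv_map G) /\
        pw_bigwedge_definable K A (prod_pw D D) (graph (@inv_map G))].

(* The structure underlying a [topologicalType] with carrier [T], so that a
   topology can be quantified over on the carrier of a group. *)
Definition topology_on (T : Type) := Topological.axioms_ T.
Definition top_space (T : Type) (tau : topology_on T) : topologicalType :=
  Topological.Pack tau.

Definition is_logic_topology (K : Type) (L : language) (M : structure L)
    (A : parameters M) (P : Type) (D : pw_presentation M P)
    (tau : topology_on P) :=
  forall C : set P, closed (C : set (top_space tau)) <-> pw_bigwedge_definable K A D C.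

Definition is_global_logic_topology (K : Type) (L : language) (M : structure L)
    (P : Type) (D : pw_presentation M P) (tau : topology_on P) :=
  exists A : parameters M,
    [/\ small_parameters K A, pw_hyperdefinable K A D,
        is_logic_topology K A D tau & accessible_space (top_space tau)].

Definition is_topological_group (G : groupType) (tau : topology_on G) :=
  let T := top_space tau in
  [/\ hausdorff_space T,
      continuous (@mul_map G : T * T -> T) &
      continuous (@inv_map G : T -> T)].

(* Main.v *)
Require Import Defs.
From Stdlib Require List.
From mathcomp Require Import all_boot all_classical topology.

(* When points are closed, the closed sets are exactly the sets whose preimage in
   every piece is type-definable. Let [E = /\_t R_t] be the equivalence relation
   of a piece [X / E], with the [R_t] definable. If some [R_t] had no finite cover
   by balls, there would be an infinite [R_t]-separated sequence; it would be
   closed and discrete, hence type-definable, against saturation. So each piece is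
   totally bounded, and saturation, applied with one ball centre for each of the
   few [R_t], makes it compact. Compactness of [E] also shows that a subset of
   [G * G] with type-definable traces on the pieces is closed in the product
   topology of each piece. As [G] is a countable direct limit of compact pieces
   (a k_omega space), such a subset is then closed in [G * G]; apply this to the
   diagonal and to the preimage of a closed set under multiplication. *)

Set Implicit Arguments.
Unset Strict Implicit.
Unset Printing Implicit Defensive.

Local Open Scope classical_set_scope.
Local Open Scope card_scope.

(** Saturation is given for one variable, whereas points of a piece are classes of small, possibly
    infinite tuples. Two facts bridge the gap. A formula involves finitely many variables, so a
    definable set can be projected along an infinite block of variables; and below a strong limit
    there are few formulas, so a type-definable set is a small directed intersection of definable
    sets. Directedness is what lets each appeal to compactness end with one single [R_t]. The [R_t]
    are not invariant under [E], so their balls do not descend to the quotient: closed sets arise as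
    images of type-definable sets, open ones as complements of such images. Type-definability of the
    graph of multiplication speaks of the logic topology of the product, a priori finer than the
    product topology; hence open rectangles have to be constructed. *)

Lemma card_le_injP (T U : Type) :
  [set: T] #<= [set: U] <-> exists f : T -> U, injective f.
Proof.
split=> [|[f fI]].
  elim/Ppointed: U => U; last by move=> /pcard_injP[f /in2TT ?]; exists f.
  rewrite !emptyE => T0.
  have nT (x : T) : False by have : [set: T] x by []; rewrite T0.
  by exists (fun x => False_rect U (nT x)) => x; case: (nT x).
have /card_eqPle[_ le1] := @inj_card_eq _ _ setT f (in2W fI).
exact: card_le_trans le1 (subset_card_le (@subsetT _ _)).
Qed.

(** A maximal graph of a partial injection is total on one of the two sides; otherwise an unmatched
    pair could be added to it. *)
Lemma inj_total (T U : Type) :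
  (exists f : T -> U, injective f) \/ (exists f : U -> T, injective f).
Proof.
pose P := [set F : set (T * U) | forall p q, F p -> F q ->
  (p.1 = q.1 <-> p.2 = q.2)].
have [F FP totF p q [A FA Ap] [B FB Bq]|F [PF Fmax]] := @Zorn_bigcup _ P.
  by have [AB|BA] := totF _ _ FA FB;
    [apply: (FP _ FB) => //; apply: AB | apply: (FP _ FA) => //; apply: BA].
have [domF|/existsNP[t ndom]] := pselect (forall t, exists u, F (t, u)).
  left; have [f Ff] := choice domF.
  by exists f => x y fxy; exact/(PF _ _ (Ff x) (Ff y)).
right; have [ranF|/existsNP[u nran]] := pselect (forall u, exists t, F (t, u)).
  have [f Ff] := choice ranF.
  by exists f => x y fxy; exact/(PF _ _ (Ff x) (Ff y)).
exfalso; apply: (Fmax (F `|` [set (t, u)])).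
  split; first by move=> p ?; left.
  by move=> /(_ (t, u)) Ftu; apply: ndom; exists u; apply: Ftu; right.
move=> [p1 p2] [q1 q2] /= [Fp|[-> ->]] [Fq|[-> ->]] //; first exact: PF Fp Fq.
  by split=> e; [case: ndom; exists p2; rewrite -e|case: nran; exists p1; rewrite -e].
by split=> e; [case: ndom; exists q2; rewrite e|case: nran; exists q1; rewrite e].
Qed.

(** * Closure of small cardinals under sums, products and finite sequences *)

Section Smallness.
Variable K : Type.
Hypothesis hK : strong_limit K.

Notation sm T := (small K [set: T]).

Lemma small_inj (T U : Type) (f : T -> U) : injective f -> sm U -> sm T.
Proof.
move=> fI [le1 nle]; have TU : [set: T] #<= [set: U] by apply/card_le_injP; exists f.
by split; [exact: card_le_trans le1|apply: contra_not nle => /card_le_trans; apply].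
Qed.

Lemma small_sum (T U : Type) : sm T -> sm U -> sm (T + U).
Proof.
suff half (A B : Type) (f : A -> B) : injective f -> sm B -> sm (A + B).
  move=> sT sU; have [[f fI]|[f fI]] := inj_total T U; first exact: half fI sU.
  apply: (small_inj (f := fun z : T + U => match z with inl x => inr x | inr x => inl x end))
    (half _ _ f fI sT).
  by move=> [x|x] [y|y] //= [->].
(* Two power sets leave room for a tag: the member [set0] marks the right summand. *)
move=> fI sB; pose g (z : A + B) : set (set B) :=
  match z with inl a => [set [set f a]] | inr b => [set [set b]; set0] end.
apply: (small_inj (f := g)); last by do 2!apply: hK.
have s0 (b : B) : set0 <> [set b] by move=> /seteqP[_ /(_ b)]; apply.
move=> [x|x] [y|y] //= /seteqP[/= xy yx].
- congr inl; apply: fI; have /= := xy [set f x] erefl.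
  by move=> /seteqP[/(_ (f x) erefl)].
- by have /s0 := yx set0 (or_intror erefl).
- by have /s0 := xy set0 (or_intror erefl).
- have /= [] := xy [set x] (or_introl erefl); first by move=> /seteqP[/(_ x erefl) ->].
  by move=> /esym/s0.
Qed.

Lemma small_prod (T U : Type) : sm T -> sm U -> sm (T * U).
Proof.
move=> sT sU; pose g (z : T * U) : set (T + U) := [set inl z.1; inr z.2].
apply: (small_inj (f := g)); last by apply: hK; exact: small_sum.
move=> [x y] [x' y'] /seteqP[/= h _]; congr (_, _).
  by case: (h (inl x) (or_introl erefl)) => // -[].
by case: (h (inr y) (or_intror erefl)) => // -[].
Qed.

Lemma small_seq (T : Type) : sm nat -> sm T -> sm (seq T).
Proof.
move=> sN sT; pose g (s : seq T) : set (nat * T) := [set p | onth s p.1 = Some p.2].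
apply: (small_inj (f := g)); last by apply: hK; exact: small_prod.
move=> s s' ess'; have {ess'} on i : onth s i = onth s' i.
  have h x : onth s i = Some x <-> onth s' i = Some x.
    by have /= := congr1 (fun A : set _ => A (i, x)) ess'; rewrite /g/= => ->.
  case e: (onth s i) => [x|]; first by apply/esym/h.
  by case e': (onth s' i) => [y|] //; move/h: e'; rewrite e.
elim: s s' on => [|x s IH] [|y s'] on //; try by move: (on 0%N).
by have [->] := on 0%N; rewrite (IH s') // => i; exact: (on i.+1).
Qed.

End Smallness.

Lemma In_mem (T : eqType) (x : T) (s : seq T) : List.In x s <-> x \in s.
Proof.
elim: s => [|y s IH] //=; rewrite in_cons.
split=> [[->|/IH ->]|/orP[/eqP ->|/IH]]; rewrite ?eqxx ?orbT //; [by left|by right].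
Qed.

Lemma finite_set_In (T : Type) (A : set T) :
  finite_set A -> exists l : seq T, forall x, A x <-> List.In x l.
Proof.
elim/Pchoice: T => T in A *; move=> /finite_seqP[s ->]; exists s => x.
by split=> /In_mem.
Qed.

Lemma existT_inj (S : Type) (F : S -> Type) (s : S) (a b : F s) :
  existT F s a = existT F s b -> a = b.
Proof.
move=> e; have := projT2_eq e; rewrite (Prop_irrelevance (projT1_eq e) erefl).
by [].
Qed.

Lemma dep_choice (I : Type) (F : I -> Type) (P : forall i, F i -> Prop) :
  (forall i, exists x, P i x) -> exists f : forall i, F i, forall i, P i (f i).
Proof. by move=> h; exists (fun i => projT1 (cid (h i))) => i; case: cid. Qed.

Section Logic.
Variables (L : language) (M : structure L).

Notation elt s a := (existT (carrier M) s a).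

Lemma tup_inh (V : Type) (sg : V -> lsort L) : inhabited (tup M sg).
Proof.
have h v : exists a : M (sg v), True by have [a] := carrier_inh M (sg v); exists a.
by have [x _] := dep_choice h; exists.
Qed.

Lemma elt_val (s s' : lsort L) (e : s' = s) (a : M s) (a' : M s') :
  elt s a = elt s' a' -> ecast s (M s) e a' = a.
Proof. by case: s / e a => a /= aa'; rewrite (existT_inj aa'). Qed.

Lemma elt_sort (s s' : lsort L) (a : M s) (a' : M s') :
  elt s a = elt s' a' -> s = s'.
Proof. by move=> e; exact: (projT1_eq e). Qed.

Lemma elt_ecast (s s' : lsort L) (e : s' = s) (a' : M s') :
  elt s (ecast s (M s) e a') = elt s' a'.
Proof. by case: s / e. Qed.

Lemma join_tup_lr (V W : Type) (sg : V -> lsort L) (tg : W -> lsort L)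
    (z : tup M (sum_sort sg tg)) : join_tup (ltup z) (rtup z) = z.
Proof. by apply: functional_extensionality_dep => -[]. Qed.

(** * Renaming variables *)

(** Renamings are partial so that a formula can move to a context with no counterpart for the
    variables outside [l]; this is how an exhausted block of quantified variables is dropped. *)
Definition renaming_ok V W (sg : V -> lsort L) (tg : W -> lsort L)
    (l : seq V) (R : V -> option W) :=
  forall v, List.In v l -> exists2 w, R v = Some w & tg w = sg v.

(** The sorts of [v] and [w] agree only propositionally, so values are compared together with their
    sorts, as dependent pairs. *)
Definition renames V W (sg : V -> lsort L) (tg : W -> lsort L)
    (l : seq V) (R : V -> option W) (x : tup M sg) (y : tup M tg) :=
  forall v w, List.In v l -> R v = Some w -> elt _ (x v) = elt _ (y w).

(* [supported l S]: [S] is definable by a formula with free variables in [l]. *)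
Definition supported V (sg : V -> lsort L) (l : seq V) (S : set (tup M sg)) :=
  forall W (tg : W -> lsort L) (R : V -> option W), renaming_ok sg tg l R ->
    exists psi : formula tg, forall x y, renames l R x y -> (sat psi y <-> S x).

Lemma renaming_ok_sub V W (sg : V -> lsort L) (tg : W -> lsort L) l l'
    (R : V -> option W) : (forall v, List.In v l -> List.In v l') ->
  renaming_ok sg tg l' R -> renaming_ok sg tg l R.
Proof. by move=> ll' h v /ll'/h. Qed.

Lemma renames_sub V W (sg : V -> lsort L) (tg : W -> lsort L) l l'
    (R : V -> option W) (x : tup M sg) (y : tup M tg) :
  (forall v, List.In v l -> List.In v l') ->
  renames l' R x y -> renames l R x y.
Proof. by move=> ll' h v w /ll'; exact: h. Qed.

Definition term_supported V (sg : V -> lsort L) s (l : seq V) (t : term sg s) :=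
  forall W (tg : W -> lsort L) (R : V -> option W), renaming_ok sg tg l R ->
    exists u : term tg s, forall x y, renames l R x y ->
      teval u y = teval (M := M) t x.

Lemma terms_supported V (sg : V -> lsort L) n (s : 'I_n -> lsort L)
    (t : forall i, term sg (s i)) :
  (forall i, exists l, term_supported l (t i)) -> exists l : seq V,
  forall W (tg : W -> lsort L) (R : V -> option W), renaming_ok sg tg l R ->
    exists u : forall i, term tg (s i), forall x y, renames l R x y ->
      forall i, teval (u i) y = teval (M := M) (t i) x.
Proof.
move=> /choice[l hl]; pose l' := List.flat_map l (enum 'I_n).
have ll' i v : List.In v (l i) -> List.In v l'.
  by move=> vi; apply/List.in_flat_map; exists i; split=> //; apply/In_mem/mem_enum.
exists l' => W tg R ok.
have [u hu] := dep_choice (fun i => hl i W tg R (renaming_ok_sub (ll' i) ok)).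
by exists u => x y xy i; apply: hu; exact: renames_sub (ll' i) xy.
Qed.

Lemma term_has_support V (sg : V -> lsort L) s (t : term sg s) :
  exists l, term_supported l t.
Proof.
elim: t => [v|f t /terms_supported[l hl]].
  exists [:: v] => W tg R /(_ v (or_introl erefl))[w Rv e].
  exists (ecast s (term tg s) e (Var tg w)) => x y /(_ v w (or_introl erefl) Rv) xy.
  by rewrite /= -(elt_val e xy); case: _ / e {xy}.
exists l => W tg R /hl[u hu]; exists (App u) => x y /hu xy /=; congr fint.
exact: functional_extensionality_dep.
Qed.

Lemma sat_supported V (sg : V -> lsort L) (phi : formula sg) :
  exists l, supported l (@sat L M V sg phi).
Proof.
elim: phi => {V sg} [V sg|V sg s t u|V sg r t|V sg phi [l1 h1] psi [l2 h2]|V sg s phi [l h]].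
- by exists nil => W tg R _; exists (Bot tg).
- pose tu (i : 'I_2) := if i == ord0 then t else u.
  have [l h] := terms_supported (fun i => term_has_support (tu i)); exists l => W tg R /h[u' hu].
  exists (Equal (u' ord0) (u' ord_max)) => x y /hu e.
  by rewrite /= !e.
- have [l h] := terms_supported (fun i => term_has_support (t i)); exists l => W tg R /h[u hu].
  exists (Rel u) => x y /hu e /=.
  by rewrite (functional_extensionality_dep e).
- exists (l1 ++ l2) => W tg R ok.
  have s1 v : List.In v l1 -> List.In v (l1 ++ l2).
    by move=> ?; apply/List.in_or_app; left.
  have s2 v : List.In v l2 -> List.In v (l1 ++ l2).
    by move=> ?; apply/List.in_or_app; right.
  have [p1 e1] := h1 _ _ _ (renaming_ok_sub s1 ok).
  have [p2 e2] := h2 _ _ _ (renaming_ok_sub s2 ok).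
  exists (Imp p1 p2) => x y xy /=.
  by rewrite (e1 _ _ (renames_sub s1 xy)) (e2 _ _ (renames_sub s2 xy)).
- pose l' := List.flat_map (fun o => if o is Some v then [:: v] else [::]) l.
  have ll' v : List.In (Some v) l -> List.In v l'.
    by move=> vl; apply/List.in_flat_map; exists (Some v); split=> //; left.
  exists l' => W tg R ok.
  (* Under the quantifier the bound variable goes to the bound variable. *)
  pose R' (o : option V) := if o is Some v then omap Some (R v) else Some None.
  have ok' : renaming_ok (ext_sort s sg) (ext_sort s tg) l R'.
    move=> [v /ll'/ok [w Rv e]|_]; last by exists None.
    by exists (Some w); rewrite //= Rv.
  have [psi hpsi] := h _ _ _ ok'; exists (All psi) => x y xy /=.
  have ren (a : M s) : renames l R' (ext_tup a x) (ext_tup a y).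
    move=> [v|] [w|] //=; last by move=> _; case: (R v).
    by move=> /ll' vl; case E: (R v) => [w'|] //= [<-]; exact: xy.
  by split=> S a; apply/(hpsi _ _ (ren a)); exact: S.
Qed.

(** * Closure properties of definable sets *)

Definition definable V (sg : V -> lsort L) (S : set (tup M sg)) :=
  exists phi : formula sg, forall x, S x <-> sat phi x.

Lemma definableP V (sg : V -> lsort L) (S : set (tup M sg)) :
  definable S <-> exists l, supported l S.
Proof.
split=> [[phi h]|[l h]].
  have [l hl] := sat_supported phi; exists l => W tg R /hl[psi hpsi].
  by exists psi => x y xy; rewrite h; exact: hpsi.
have [|phi hphi] := h V sg Some; first by move=> v _; exists v.
by exists phi => x; apply: iff_sym; apply: hphi => v w _ [->].
Qed.

(** The finite character that lets Zorn's lemma pass to unions of chains in [consistent_chain]. *)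
Lemma definable_support V (sg : V -> lsort L) (S : set (tup M sg)) :
  definable S -> exists l, forall x y, (forall v, List.In v l -> x v = y v) ->
    S x -> S y.
Proof.
move=> /definableP[l h]; have [|phi hphi] := h V sg Some.
  by move=> v _; exists v.
exists l => x y xy Sx; apply/(hphi y y); first by move=> v w _ [->].
by apply/(hphi x y) => // v w vl [<-]; rewrite xy.
Qed.

(** Substitutions of variables for variables, described by their effect on tuples; projections and
    joins qualify without any transport along sorts. *)
Definition reindexing V W (sg : V -> lsort L) (tg : W -> lsort L)
    (g : tup M tg -> tup M sg) :=
  forall v, exists w, forall y, elt _ (g y v) = elt _ (y w).

Lemma definable_preimage V W (sg : V -> lsort L) (tg : W -> lsort L)
    (g : tup M tg -> tup M sg) (S : set (tup M sg)) :
  reindexing g -> definable S -> definable (g @^-1` S).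
Proof.
move=> /choice[r hr] /definableP[l /(_ W tg (Some \o r))[v _|phi hphi]].
  by exists (r v) => //; have [y] := tup_inh tg; exact: esym (elt_sort (hr v y)).
by exists phi => y; rewrite (hphi (g y) y) // => v w _ [<-]; exact: hr.
Qed.

Lemma definable_imp V (sg : V -> lsort L) (S T : set (tup M sg)) :
  definable S -> definable T -> definable [set x | S x -> T x].
Proof.
by move=> [p hp] [q hq]; exists (Imp p q) => x /=; rewrite hp hq.
Qed.

Lemma definable0 V (sg : V -> lsort L) : definable (set0 : set (tup M sg)).
Proof. by exists (Bot sg). Qed.

Lemma definable_iff V (sg : V -> lsort L) (S T : set (tup M sg)) :
  (forall x, S x <-> T x) -> definable S -> definable T.
Proof. by move=> ST [p hp]; exists p => x; rewrite -ST. Qed.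

Lemma definable_setC V (sg : V -> lsort L) (S : set (tup M sg)) :
  definable S -> definable (~` S).
Proof. by move=> dS; apply: definable_imp dS (definable0 _). Qed.

Lemma definable_setI V (sg : V -> lsort L) (S T : set (tup M sg)) :
  definable S -> definable T -> definable (S `&` T).
Proof.
move=> dS dT; apply: definable_iff (definable_setC (definable_imp dS (definable_setC dT))).
move=> x; split=> [h|[Sx Tx] /(_ Sx)//].
by split; apply: contrapT => n; apply: h => // Sx.
Qed.

Lemma definableT V (sg : V -> lsort L) : definable (setT : set (tup M sg)).
Proof. by apply: definable_iff (definable_setC (definable0 sg)) => x; split=> // _ []. Qed.

Lemma definable_list V (sg : V -> lsort L) (I : Type) (S : I -> set (tup M sg))
    (l : seq I) : (forall i, definable (S i)) ->
  definable [set x | forall i, List.In i l -> S i x].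
Proof.
move=> dS; elim: l => [|i l IH]; first by apply: definable_iff (definableT sg) => x; split=> // _ i [].
apply: definable_iff (definable_setI (dS i) IH) => x /=.
split=> [[Si Sl] j [<- //|/Sl //]|h].
by split=> [|j jl]; apply: h; [left|right].
Qed.

Lemma definable_ex1 V (sg : V -> lsort L) s (S : set (tup M (ext_sort s sg))) :
  definable S -> definable [set x | exists a : M s, S (ext_tup a x)].
Proof.
move=> /definable_setC[phi h]; apply: definable_iff (definable_setC (ex_intro _ (All phi) (fun=> iff_refl _))).
move=> x /=; split=> [/existsNP[a]|[a Sa] /(_ a)/h //].
by rewrite -h => /contrapT; exists a.
Qed.

(* Each variable of [k] is renamed in turn to a fresh variable on the left,
   over which one then quantifies. *)
Lemma supported_ex (W : Type) (tg : W -> lsort L) (k : seq W) :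
  forall V (sg : V -> lsort L) (S : set (tup M (sum_sort sg tg))) l,
  supported l S -> (forall w, List.In (inr w) l -> List.In w k) ->
  definable [set x | exists y, S (join_tup x y)].
Proof.
elim: k => [|w0 k IH] V sg S l hS lk.
  have [|phi hphi] := hS V sg (fun z => if z is inl v then Some v else None).
    by move=> [v _|w /lk //]; exists v.
  exists phi => x; split=> [[y Sy]|phix].
    by apply/(hphi (join_tup x y)) => // -[v|w] w' //= _ [<-].
  have [y] := tup_inh tg; exists y; apply/(hphi (join_tup x y) x) => // -[v|w] w' //= _ [<-].
  by [].
pose r (z : V + W) : option V + W := match z with
  | inl v => inl (Some v)
  | inr w => if pselect (w = w0) then inl None else inr w end.
pose sg' := ext_sort (tg w0) sg.
have rs z : sum_sort sg' tg (r z) = sum_sort sg tg z.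
  by case: z => [v|w] //=; case: pselect => /= [->|].
pose g (z : tup M (sum_sort sg' tg)) : tup M (sum_sort sg tg) :=
  fun v => ecast s (M s) (rs v) (z (r v)).
have gE z v : elt _ (g z v) = elt _ (z (r v)) by exact: elt_ecast.
have hS' : supported (map r l) (g @^-1` S).
  move=> W' tg' R ok; have [z zl|phi hphi] := hS W' tg' (R \o r).
    have [|w Rw e] := ok (r z); first exact: List.in_map.
    by exists w; rewrite // e rs.
  exists phi => x y xy; apply: hphi => v w vl Rv.
  by rewrite gE; apply: xy => //; exact: List.in_map.
have {IH hS'} := IH _ _ _ _ hS' _; case=> [w|phi hphi].
  move=> /List.in_map_iff[[v|w'] [] //=]; case: pselect => //= w'w0 [<-] /lk[w0w'|//].
  by case: w'w0.
have := definable_ex1 (ex_intro _ phi hphi : definable (fun x => _)).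
apply: definable_iff => x /=; split=> [[a [y Sy]]|[y Sy]].
  exists (rtup (g (join_tup (ext_tup a x) y))).
  rewrite (_ : join_tup x _ = g (join_tup (ext_tup a x) y)) //.
  apply: functional_extensionality_dep => -[v|w] //.
  by apply: (existT_inj (F := carrier M)); rewrite gE.
exists (y w0), y; rewrite (_ : g _ = join_tup x y) //.
apply: functional_extensionality_dep => -[v|w]; apply: (existT_inj (F := carrier M)); rewrite gE //=.
by case: pselect => /= [->|].
Qed.

(** [W] may be infinite, but only the variables of [W] in a finite support have to be quantified. *)
Lemma definable_ex V W (sg : V -> lsort L) (tg : W -> lsort L)
    (S : set (tup M (sum_sort sg tg))) :
  definable S -> definable [set x | exists y, S (join_tup x y)].
Proof.
move=> /definableP[l hl].
apply: (supported_ex (k := List.flat_map (fun z => if z is inr w then [:: w] else [::]) l) hl).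
by move=> w wl; apply/List.in_flat_map; exists (inr w); split=> //; left.
Qed.

End Logic.

(** * Counting formulas *)

Section Codes.
Variables (L : language) (M : structure L) (V0 : Type).

Notation elt s a := (existT (carrier M) s a).

(** Formulas form a family indexed by contexts that grow under binders. Untyped trees over these
    labels are easier to count, since they embed into finite sequences. *)
Definition label := ((V0 + nat) + (lsort L + func L + rel_symb L))%type.

Fixpoint term_code V (sg : V -> lsort L) s (t : term sg s) (r : V -> V0 + nat) :
    GenTree.tree label :=
  match t with
  | Var v => GenTree.Leaf (inl (r v))
  | App f t => GenTree.Node 0 (GenTree.Leaf (inr (inl (inr f))) ::
                 [seq term_code (t i) r | i <- enum 'I_(farity f)])
  end.

(* Bound variables are named by their de Bruijn level [n]. *)
Fixpoint formula_code V (sg : V -> lsort L) (phi : formula sg)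
    (r : V -> V0 + nat) (n : nat) : GenTree.tree label :=
  match phi with
  | Bot => GenTree.Node 1 [::]
  | Equal s t u => GenTree.Node 2 [:: term_code t r; term_code u r]
  | Rel R t => GenTree.Node 3 (GenTree.Leaf (inr (inr R)) ::
                 [seq term_code (t i) r | i <- enum 'I_(rarity R)])
  | Imp phi psi => GenTree.Node 4 [:: formula_code phi r n; formula_code psi r n]
  | All s phi => GenTree.Node 5 [:: GenTree.Leaf (inr (inl (inl s)));
      formula_code phi (fun o => if o is Some v then r v else inr n) n.+1]
  end.

Definition same_names V V' (sg : V -> lsort L) (sg' : V' -> lsort L)
    (r : V -> V0 + nat) (r' : V' -> V0 + nat) (x : tup M sg) (x' : tup M sg') :=
  forall v v', r v = r' v' -> elt _ (x v) = elt _ (x' v').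

Lemma term_code_eval V V' (sg : V -> lsort L) (sg' : V' -> lsort L)
    (r : V -> V0 + nat) (r' : V' -> V0 + nat) (x : tup M sg) (x' : tup M sg')
    s s' (t : term sg s) (t' : term sg' s') :
  same_names r r' x x' -> term_code t r = term_code t' r' ->
  elt _ (teval t x) = elt _ (teval t' x').
Proof.
move=> xx'; elim: t s' t' => [v|f t IH] s' [v'|f' t'] //= [].
  by move=> /xx'.
move=> ff'; case: f' / ff' t' => t' /eq_in_map h.
rewrite (_ : (fun i => _) = (fun i => teval (t' i) x')) //.
apply: functional_extensionality_dep => i.
by apply: (existT_inj (F := carrier M)); apply: IH; apply: h; rewrite mem_enum.
Qed.

(** The two formulas may live in different contexts, so equal codes are only claimed to give equal
    truth values. The bounds by [n] make the level [n] a fresh name when a quantifier is crossed. *)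
Lemma formula_code_sat V V' (sg : V -> lsort L) (sg' : V' -> lsort L)
    (r : V -> V0 + nat) (r' : V' -> V0 + nat) n
    (phi : formula sg) (phi' : formula sg') (x : tup M sg) (x' : tup M sg') :
  (forall v k, r v = inr k -> (k < n)%N) ->
  (forall v k, r' v = inr k -> (k < n)%N) ->
  same_names r r' x x' -> formula_code phi r n = formula_code phi' r' n ->
  sat phi x <-> sat phi' x'.
Proof.
elim: phi V' sg' r r' n phi' x x' => {V sg} [V sg|V sg s t u|V sg R t|V sg phi IH1 psi IH2|V sg s phi IH]
  V' sg' r r' n [|s' t' u'|R' t'|phi' psi'|s' phi'] x x' rn rn' xx' //= [].
- move=> /(term_code_eval xx') e1 /(term_code_eval xx') e2.
  (* The code of an equation omits its sort, which is recovered from the values of the terms. *)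
  have ss' := elt_sort e1; case: s' / ss' t' u' e1 e2 => t' u'.
  by move=> /(existT_inj (F := carrier M)) -> /(existT_inj (F := carrier M)) ->.
- move=> RR'; case: R' / RR' t' => t' /eq_in_map h.
  rewrite (_ : (fun i => _) = (fun i => teval (t' i) x')) //.
  apply: functional_extensionality_dep => i.
  apply: (existT_inj (F := carrier M)); apply: (term_code_eval xx').
  by apply: h; rewrite mem_enum.
- move=> /(IH1 _ _ _ _ _ _ _ _ rn rn' xx') h1 /(IH2 _ _ _ _ _ _ _ _ rn rn' xx') h2.
  by rewrite h1 h2.
- move=> ss'; case: s' / ss' phi' => phi' e.
  have h (a : M s) : sat phi (ext_tup a x) <-> sat phi' (ext_tup a x').
    apply: IH e; first by move=> [v k /rn/ltnW|k [->]].
      by move=> [v k /rn'/ltnW|k [->]].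
    move=> [v|] [v'|] //=; first exact: xx'.
      by move=> /rn; rewrite ltnn.
    by move=> /esym/rn'; rewrite ltnn.
  by split=> S a; apply/h; exact: S.
Qed.

End Codes.

Lemma formula_code_inj (L : language) (M : structure L) V (sg : V -> lsort L)
    (phi psi : formula sg) (x : tup M sg) :
  formula_code phi (fun v => inl v : V + nat) 0 =
  formula_code psi (fun v => inl v : V + nat) 0 ->
  sat phi x <-> sat psi x.
Proof.
apply: formula_code_sat => // v v' [<-] //.
Qed.

Lemma small_code (K : Type) (L : language) (V : Type) :
  strong_limit K -> language_small K L -> small K [set: V] ->
  small K [set: GenTree.tree (label L V)].
Proof.
move=> hK hL sV; have sN : small K [set: nat] by apply: (small_inj (f := inr)) hL => ? ? [].
have sL : small K [set: lsort L + func L + rel_symb L].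
  by apply: (small_inj (f := inl)) hL => ? ? [].
apply: (small_inj (f := @GenTree.encode _)); first exact: (pcan_inj (@GenTree.codeK _)).
by apply: small_seq => //; do !apply: small_sum => //.
Qed.

(** * Compactness for small tuples of variables *)

Section Compactness.
Variables (K : Type) (L : language) (M : structure L).
Hypotheses (hK : strong_limit K) (hsat : saturated K M).

Notation elt s a := (existT (carrier M) s a).

Section Partial.
Variables (V B : Type) (sg : V -> lsort L) (tg : B -> lsort L) (b : tup M tg).
Variables (I : Type) (S : I -> set (tup M (sum_sort sg tg))).
Hypotheses (sV : small K [set: V]) (sB : small K [set: B]).
Hypothesis dS : forall i, definable (S i).

(* The values of [p.2] outside [p.1] are irrelevant. *)
Definition consistent (p : set V * tup M sg) := forall l : seq I,
  exists x, (forall v, p.1 v -> x v = p.2 v) /\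
            forall i, List.In i l -> S i (join_tup x b).

Definition extends (p q : set V * tup M sg) :=
  p.1 `<=` q.1 /\ forall v, p.1 v -> q.2 v = p.2 v.

(** A finite list of conditions depends on finitely many coordinates; those lying in the union of
    the domains already lie in the domain of one member of the chain. *)
Lemma consistent_chain (A : set (set V * tup M sg)) p0 : A p0 ->
  (forall p, A p -> consistent p) ->
  (forall p q, A p -> A q -> extends p q \/ extends q p) ->
  exists q, consistent q /\ forall p, A p -> extends p q.
Proof.
move=> Ap0 cA tA; pose U v := exists2 p, A p & p.1 v.
have [x hx] : exists x : tup M sg, forall v p, A p -> p.1 v -> x v = p.2 v.
  apply: (dep_choice (P := fun v a => forall p, A p -> p.1 v -> a = p.2 v)) => v.
  have [[p Ap pv]|nU] := pselect (U v).
    exists (p.2 v) => q Aq qv.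
    by have [[_ /(_ v pv)]|[_ /(_ v qv)]] := tA _ _ Ap Aq.
  by exists (p0.2 v) => q Aq qv; case: nU; exists q.
exists (U, x); split; last first.
  by move=> p Ap; split=> v /= pv; [exists p|exact: hx pv].
move=> l; have [sp hsp] := choice (fun i => definable_support (dS i)).
have [p Ap hp] : exists2 p, A p & forall v,
    List.In (inl v) (List.flat_map sp l) -> U v -> p.1 v.
  elim: (List.flat_map sp l) => [|[v|w] k [p Ap hp]]; first by exists p0.
    have [[q Aq qv]|nU] := pselect (U v).
      have [[pq _]|[qp _]] := tA _ _ Ap Aq.
        by exists q => // v' [[<- //]|/hp h /h/pq].
      by exists p => // v' [[<- _]|/hp h /h //]; exact: qp.
    by exists p => // v' [[<- /nU]|/hp].
  by exists p => // v' [//|/hp].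
have [y [yp yS]] := cA p Ap l.
(* On the coordinates that the conditions in [l] mention, this agrees with [y]; overwriting the
   others is harmless. *)
exists (fun v => if pselect (U v) then x v else y v); split=> [v /=|i il].
  by case: pselect.
apply: hsp (yS i il) => -[v vi|//] /=; case: pselect => //= Uv.
have pv : p.1 v by apply: hp => //; apply/List.in_flat_map; exists i.
by rewrite (yp _ pv) (hx v p).
Qed.

Definition update (v0 : V) (a : M (sg v0)) (x : tup M sg) : tup M sg := fun v =>
  match pselect (v0 = v) with
  | left e => ecast v (M (sg v)) e a
  | right _ => x v
  end.

Lemma update_same v0 (a : M (sg v0)) x : update a x v0 = a.
Proof.
rewrite /update; case: pselect => // e.
by rewrite (Prop_irrelevance e erefl).
Qed.

Lemma update_other v0 (a : M (sg v0)) x v : v0 <> v -> update a x v = x v.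
Proof. by rewrite /update; case: pselect. Qed.

(** The values at [v0] compatible with a finite list of conditions form a set definable over [p.2]
    and [b], obtained by quantifying away the undetermined coordinates. Saturation in one variable
    meets all these sets at once. *)
Lemma consistent_extend (p : set V * tup M sg) v0 : consistent p -> ~ p.1 v0 ->
  exists a : M (sg v0), consistent (p.1 `|` [set v0], update a p.2).
Proof.
move=> cp nv0; pose s := sg v0; pose c := join_tup p.2 b.
pose ok (l : seq I) (a : M s) := exists x, [/\ forall v, p.1 v -> x v = p.2 v,
  x v0 = a & forall i, List.In i l -> S i (join_tup x b)].
have ok_def l : exists th : formula (ext_sort s (sum_sort sg tg)),
    forall a, sat th (ext_tup a c) <-> ok l a.
  (* Coordinates in [p.1] are read from the parameters, [v0] from the new variable, and all others
     from the block to be quantified. *)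
  pose g (z : tup M (sum_sort (ext_sort s (sum_sort sg tg)) sg)) :
      tup M (sum_sort sg tg) :=
    join_tup (fun v => if pselect (p.1 v) then z (inl (Some (inl v)))
                       else update (z (inl None)) (rtup z) v)
             (fun w => z (inl (Some (inr w)))).
  have rg : reindexing g.
    move=> [v|w]; last by exists (inl (Some (inr w))).
    have [pv|npv] := pselect (p.1 v).
      by exists (inl (Some (inl v))) => z /=; case: pselect.
    have [e|ne] := pselect (v0 = v).
      exists (inl None) => z /=; case: pselect => //= _.
      by case: v / e {npv}; rewrite update_same.
    exists (inr v) => z /=; case: pselect => //= _.
    by rewrite update_other.
  have [th hth] := definable_ex (definable_preimage rg (definable_list l dS)).
  exists th => a; rewrite -hth; split=> [[y hy]|[x [xp xv0 xS]]].
    exists (ltup (g (join_tup (ext_tup a c) y))); split=> [v pv||i il].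
    - by rewrite /ltup /=; case: pselect.
    - by rewrite /ltup /=; case: pselect => //= _; exact: update_same.
    - by have := hy i il; rewrite /= -[X in S i X]join_tup_lr.
  exists x => i /xS; rewrite /= (_ : g _ = join_tup x b) //.
  apply: functional_extensionality_dep => -[v|//] /=.
  case: pselect => /= [/xp ->//|_].
  have [e|ne] := pselect (v0 = v); last by rewrite update_other.
  by case: v / e; rewrite update_same.
have [F finF FS|a ha] := @hsat _ _ c s [set th | exists l, forall a,
    sat th (ext_tup a c) <-> ok l a] (small_sum hK sV sB).
  have [k hk] := finite_set_In finF.
  have [l hl] : exists l, forall a, ok l a -> forall th, F th -> sat th (ext_tup a c).
    suff [l hl] : exists l, forall a, ok l a -> forall th, List.In th k -> sat th (ext_tup a c).
      by exists l => a /hl h th /hk; exact: h.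
    have : forall th, List.In th k -> F th by move=> th /hk.
    elim: k {hk} => [|th k IH] kF; first by exists [::].
    have [th' kth'|l hl] := IH; first by apply: kF; right.
    have [l' hl'] := FS th (kF th (or_introl erefl)).
    exists (l' ++ l) => a [x [xp xv0 xS]] th' [<-|th'k].
      by apply/hl'; exists x; split=> // i il; apply/xS/List.in_or_app; left.
    by apply: hl th'k; exists x; split=> // i il; apply/xS/List.in_or_app; right.
  have [x [xp xS]] := cp l; exists (x v0); apply: hl.
  by exists x.
exists a => l; have [th hth] := ok_def l.
have /hth[x [xp xv0 xS]] : sat th (ext_tup a c) by apply: ha; exists l.
exists x; split=> //= v [pv|->]; last by rewrite update_same.
by rewrite update_other ?xp // => e; apply: nv0; rewrite e.
Qed.

(** A maximal consistent partial tuple is total by [consistent_extend], and consistency for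
    one-element lists then gives every condition. *)
Theorem compactness :
  (forall l : seq I, exists x, forall i, List.In i l -> S i (join_tup x b)) ->
  exists x, forall i, S i (join_tup x b).
Proof.
move=> fip; pose T := {p | consistent p}.
have [x0] := tup_inh M sg.
have c0 : consistent (set0, x0) by move=> l; have [x xS] := fip l; exists x.
pose R (p q : T) := `[< extends (sval p) (sval q) >].
have [||A tA|[p cp] pmax] := @ZL_preorder T (exist _ _ c0) R.
- by move=> p; apply/asboolP; split.
- move=> p q r /asboolP[pq1 pq2] /asboolP[qr1 qr2]; apply/asboolP; split.
    exact: subset_trans qr1.
  by move=> v pv; rewrite qr2 ?pq2 //; exact: pq1.
- have [[p0 Ap0]|/set0P nA] := pselect (A !=set0); last first.
    by exists (exist _ _ c0) => s As; case: nA; apply/set0P; exists s.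
  have [|||q [cq hq]] := @consistent_chain [set sval p | p in A] (sval p0).
  + by exists p0.
  + by move=> _ [[p cp] _ <-].
  + by move=> _ _ [p Ap <-] [q Aq <-]; case: (tA _ _ Ap Aq) => /asboolP; [left|right].
  by exists (exist _ _ cq) => p Ap; apply/asboolP/hq; exists p.
have full v : p.1 v.
  apply: contrapT => npv; have [a ca] := consistent_extend cp npv.
  have /pmax/asboolP[/= sub _] : R (exist _ _ cp) (exist _ _ ca).
    apply/asboolP; split=> /= [w|w pw]; first by left.
    by rewrite update_other // => e; apply: npv; rewrite e.
  by apply: npv; apply: sub; right.
exists p.2 => i; have [x [xp /(_ i (or_introl erefl))]] := cp [:: i].
by rewrite (_ : x = p.2) //; apply: functional_extensionality_dep => v; exact: xp.
Qed.

End Partial.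
End Compactness.

(** * Type-definable sets *)

(** Proves [reindexing] for combinations of [ltup], [rtup] and [join_tup]: the index is split into
    its summands, and chains of [inl] and [inr] up to the given depth are tried as its source. *)
Ltac reindex_to n w :=
  first [ exists w; intro; reflexivity
        | lazymatch n with
          | S ?m => first [ let c := uconstr:(inl w) in reindex_to m c
                          | let c := uconstr:(inr w) in reindex_to m c ]
          end ].

Ltac reindex := let v := fresh "v" in
  intro v; repeat destruct v as [v|v]; reindex_to 4 v.

Lemma directed_list (T I : Type) (R : I -> set T) (l : seq I) :
  inhabited I -> (forall i j, exists k, forall x, R k x -> R i x /\ R j x) ->
  exists k, forall i, List.In i l -> R k `<=` R i.
Proof.
move=> [i0] dir; elim: l => [|i l [k hk]]; first by exists i0.
have [k' hk'] := dir i k; exists k' => j [<-|jl] x /hk'[] //.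
by move=> _; exact: hk.
Qed.

(** * Sets definable over a tuple of parameters *)

Section DefOver.
Variables (L : language) (M : structure L).

Notation elt s a := (existT (carrier M) s a).

Definition def_over B (tg : B -> lsort L) (b : tup M tg) V (sg : V -> lsort L)
    (S : set (tup M sg)) :=
  exists2 T : set (tup M (sum_sort sg tg)), definable T &
    forall x, S x <-> T (join_tup x b).

Lemma def_over_setC B (tg : B -> lsort L) (b : tup M tg) V (sg : V -> lsort L)
    (S : set (tup M sg)) : def_over b S -> def_over b (~` S).
Proof.
move=> [T dT h]; exists (~` T); first exact: definable_setC.
by move=> x; rewrite /setC /= h.
Qed.

Lemma def_over_setI B (tg : B -> lsort L) (b : tup M tg) V (sg : V -> lsort L)
    (S S' : set (tup M sg)) :
  def_over b S -> def_over b S' -> def_over b (S `&` S').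
Proof.
move=> [T dT h] [T' dT' h']; exists (T `&` T'); first exact: definable_setI.
by move=> x; rewrite /setI /= h h'.
Qed.

Lemma def_over_list B (tg : B -> lsort L) (b : tup M tg) V (sg : V -> lsort L)
    (I : Type) (S : I -> set (tup M sg)) (l : seq I) :
  (forall i, def_over b (S i)) ->
  def_over b [set x | forall i, List.In i l -> S i x].
Proof.
move=> /(_ _)/cid2 h; exists [set z | forall i, List.In i l -> s2val (h i) z].
  by apply: definable_list => i; case: (h i).
by move=> x; split=> hx i /hx; case: (h i) => T dT hT /=; apply hT.
Qed.

Lemma def_over_preimage B (tg : B -> lsort L) (b : tup M tg) V W
    (sg : V -> lsort L) (ug : W -> lsort L) (g : tup M ug -> tup M sg)
    (S : set (tup M sg)) :
  reindexing g -> def_over b S -> def_over b (g @^-1` S).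
Proof.
move=> rg [T dT h].
exists ((fun z => join_tup (g (ltup z)) (rtup z)) @^-1` T); last by move=> y; exact: h.
apply: definable_preimage dT => -[v|w]; last by exists (inr w).
by have [w hw] := rg v; exists (inl w) => y; exact: hw.
Qed.

(** Brings sets with different parameters over a common tuple, as an application of saturation
    requires. *)
Lemma def_over_weaken B C (tg : B -> lsort L) (ug : C -> lsort L)
    (b : tup M tg) (c : tup M ug) (r : B -> C) V (sg : V -> lsort L)
    (S : set (tup M sg)) :
  (forall w, elt _ (b w) = elt _ (c (r w))) -> def_over b S -> def_over c S.
Proof.
move=> bc [T dT h]; have e w : ug (r w) = tg w by rewrite (elt_sort (bc w)).
pose g (z : tup M (sum_sort sg ug)) : tup M (sum_sort sg tg) :=
  join_tup (ltup z) (fun w => ecast s (M s) (e w) (z (inr (r w)))).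
exists (g @^-1` T).
  apply: definable_preimage dT => -[v|w]; first by exists (inl v).
  by exists (inr (r w)) => y; exact: elt_ecast.
move=> x; rewrite h /= (_ : g _ = join_tup x b) //.
by apply: functional_extensionality_dep => -[v|w] //=; exact: elt_val.
Qed.

Lemma def_over_fix B (tg : B -> lsort L) (b : tup M tg) V W
    (sg : V -> lsort L) (ug : W -> lsort L) (c : tup M ug)
    (S : set (tup M (sum_sort sg ug))) :
  def_over b S -> def_over (join_tup b c) [set x | S (join_tup x c)].
Proof.
move=> [T dT h].
pose g (z : tup M (sum_sort sg (sum_sort tg ug))) :=
  join_tup (join_tup (ltup z) (rtup (rtup z))) (ltup (rtup z)).
exists (g @^-1` T); last by move=> x; exact: h.
by apply: definable_preimage dT; reindex.
Qed.

Lemma def_over_join_l B C (tg : B -> lsort L) (ug : C -> lsort L)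
    (b : tup M tg) (c : tup M ug) V (sg : V -> lsort L) (S : set (tup M sg)) :
  def_over b S -> def_over (join_tup b c) S.
Proof. exact: (def_over_weaken (r := inl)). Qed.

Lemma def_over_join_r B C (tg : B -> lsort L) (ug : C -> lsort L)
    (b : tup M tg) (c : tup M ug) V (sg : V -> lsort L) (S : set (tup M sg)) :
  def_over c S -> def_over (join_tup b c) S.
Proof. exact: (def_over_weaken (r := inr)). Qed.

End DefOver.

Section TypeDefinable.
Variables (K : Type) (L : language) (M : structure L).
Hypotheses (hK : strong_limit K) (hL : language_small K L) (hsat : saturated K M).

Notation sm T := (small K [set: T]).
Notation TD := (type_definable K).

Lemma td_intro B (tg : B -> lsort L) (b : tup M tg) V (sg : V -> lsort L)
    (I : Type) (R : I -> set (tup M sg)) (S : set (tup M sg)) :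
  sm B -> (forall i, def_over b (R i)) -> (forall x, S x <-> forall i, R i x) ->
  TD S.
Proof.
move=> sB dR SR; exists B, tg, b.
exists [set phi | exists i, forall x, R i x <-> sat phi (join_tup x b)].
split=> // x; rewrite SR; split=> [Rx phi [i <-] //|h i].
have [T [phi hphi] hT] := dR i; have ok y : R i y <-> sat phi (join_tup y b).
  by rewrite hT.
by apply/ok/h; exists i.
Qed.

Lemma td_def B (tg : B -> lsort L) (b : tup M tg) V (sg : V -> lsort L)
    (S : set (tup M sg)) : sm B -> def_over b S -> TD S.
Proof.
move=> sB dS; apply: (td_intro (R := fun _ : unit => S)) sB (fun=> dS) _.
by move=> x; split=> // /(_ tt).
Qed.

(* The index type is small because there are few formulas up to renaming of
   bound variables. *)
Lemma td_family V (sg : V -> lsort L) (S : set (tup M sg)) : sm V -> TD S ->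
  exists B (tg : B -> lsort L) (b : tup M tg) (I : Type) (R : I -> set (tup M sg)),
  [/\ sm B /\ sm I, forall i, def_over b (R i), forall x, S x <-> forall i, R i x,
      inhabited I & forall i j, exists k, forall x, R k x -> R i x /\ R j x].
Proof.
move=> sV [B [tg [b [Sigma [sB SSigma]]]]]; exists B, tg, b.
pose C := GenTree.tree (label L (V + B)).
pose code (phi : formula (sum_sort sg tg)) := formula_code phi (fun v => inl v : (V + B) + nat) 0.
pose R0 (c : C) : set (tup M sg) :=
  [set x | forall phi, Sigma phi -> code phi = c -> sat phi (join_tup x b)].
have sN : sm nat by apply: (small_inj (f := inr)) hL => ? ? [].
have dR0 c : def_over b (R0 c).
  have [[phi Sphi cphi]|nc] := pselect (exists2 phi, Sigma phi & code phi = c).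
    exists (sat phi); first by exists phi.
    move=> x; split=> [h|h psi Spsi cpsi]; first exact: h.
    have e : code psi = code phi by rewrite cpsi.
    by apply/(formula_code_inj _ e).
  exists setT; first exact: definableT.
  by move=> x; split=> // _ phi Sphi cphi; case: nc; exists phi.
(* Finite lists of codes make the family directed: concatenation gives the intersection. *)
exists (seq C), (fun l => [set x | forall c, List.In c l -> R0 c x]); split.
- split=> //; apply: small_seq => //; apply: small_code => //; exact: small_sum.
- by move=> l; exact: def_over_list.
- move=> x; rewrite SSigma; split=> [h l c _ phi Sphi _|h phi Sphi]; first exact: h.
  by apply: (h [:: code phi] (code phi) (or_introl erefl)).
- by split; exact: [::].
move=> l l'; exists (l ++ l') => x h; split=> c cl; apply: h.
  by apply/List.in_or_app; left.
by apply/List.in_or_app; right.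
Qed.

Lemma def_compact V (sg : V -> lsort L) B (tg : B -> lsort L) (b : tup M tg)
    (I : Type) (R : I -> set (tup M sg)) :
  sm V -> sm B -> (forall i, def_over b (R i)) ->
  (forall l, exists x, forall i, List.In i l -> R i x) ->
  exists x, forall i, R i x.
Proof.
move=> sV sB dR fip; have [T hT] : exists T : I -> set (tup M (sum_sort sg tg)),
    forall i, definable (T i) /\ forall x, R i x <-> T i (join_tup x b).
  apply: (dep_choice (P := fun i T => definable T /\
    forall x, R i x <-> T (join_tup x b))) => i.
  by have [T dT h] := dR i; exists T.
have [|l|x hx] := @compactness _ _ _ hK hsat _ _ sg tg b _ T sV sB.
- by move=> i; have [] := hT i.
- by have [x hx] := fip l; exists x => i /hx; apply (hT i).2.
by exists x => i; apply/(hT i).2.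
Qed.

(** Directedness replaces finitely many [R i] by one, and [S] contributes the definable conditions
    that cut it out. *)
Lemma td_compact V (sg : V -> lsort L) B (tg : B -> lsort L) (b : tup M tg)
    (I : Type) (R : I -> set (tup M sg)) (S : set (tup M sg)) :
  sm V -> sm B -> TD S -> (forall i, def_over b (R i)) -> inhabited I ->
  (forall i j, exists k, forall x, R k x -> R i x /\ R j x) ->
  (forall i, exists2 x, S x & R i x) ->
  exists2 x, S x & forall i, R i x.
Proof.
move=> sV sB tS dR i0 dir RS.
have [C [ug [c [J [Q [[sC _] dQ SQ _ _]]]]]] := td_family sV tS.
have [||x hx] := @def_compact _ sg _ _ (join_tup b c) (I + J)
  (fun z => match z with inl i => R i | inr j => Q j end) sV (small_sum hK sB sC).
- by move=> [i|j]; [exact: def_over_join_l|exact: def_over_join_r].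
- move=> l; pose l' := List.flat_map (fun z => if z is inl i then [:: i] else [::]) l.
  have [k hk] := directed_list l' i0 dir; have [x Sx Rx] := RS k.
  exists x => -[i il|j _]; last by move/SQ: Sx.
  by apply: hk Rx; apply/List.in_flat_map; exists (inl i); split=> //; left.
by exists x => [|i]; [apply/SQ => j; exact: (hx (inr j))|exact: (hx (inl i))].
Qed.

Lemma td_iff V (sg : V -> lsort L) (S T : set (tup M sg)) :
  (forall x, S x <-> T x) -> TD S -> TD T.
Proof.
move=> ST [B [tg [b [Sigma [sB h]]]]]; exists B, tg, b, Sigma; split=> // x.
by rewrite -ST.
Qed.

Lemma td_setI V (sg : V -> lsort L) (S T : set (tup M sg)) :
  sm V -> TD S -> TD T -> TD (S `&` T).
Proof.
move=> sV tS tT.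
have [B [tg [b [I [P [[sB _] dP SP _ _]]]]]] := td_family sV tS.
have [C [ug [c [J [Q [[sC _] dQ TQ _ _]]]]]] := td_family sV tT.
apply: (@td_intro _ _ (join_tup b c) _ _ (I + J)
  (fun z => match z with inl i => P i | inr j => Q j end) _ (small_sum hK sB sC)).
  by move=> [i|j]; [exact: def_over_join_l|exact: def_over_join_r].
move=> x; split=> [[/SP Px /TQ Qx] [i|j] //|h].
by split; [apply/SP => i; exact: (h (inl i))|apply/TQ => j; exact: (h (inr j))].
Qed.

Lemma td_preimage V W (sg : V -> lsort L) (ug : W -> lsort L)
    (g : tup M ug -> tup M sg) (S : set (tup M sg)) :
  sm V -> reindexing g -> TD S -> TD (g @^-1` S).
Proof.
move=> sV rg tS.
have [B [tg [b [I [P [[sB _] dP SP _ _]]]]]] := td_family sV tS.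
apply: (td_intro (R := fun i => g @^-1` P i)) sB _ _.
  by move=> i; exact: def_over_preimage.
by move=> x; rewrite /preimage /= SP.
Qed.

(** Saturation exchanges the quantifier with the directed intersection: for fixed [x], a witness for
    each [P i] yields a common one. *)
Lemma td_ex V W (sg : V -> lsort L) (ug : W -> lsort L)
    (S : set (tup M (sum_sort sg ug))) :
  sm V -> sm W -> TD S -> TD [set x | exists y, S (join_tup x y)].
Proof.
move=> sV sW tS.
have [B [tg [b [I [P [[sB _] dP SP i0 dir]]]]]] := td_family (small_sum hK sV sW) tS.
apply: (td_intro (R := fun i => [set x | exists y, P i (join_tup x y)])) (sB) _ _.
  move=> i; have [T dT PT] := dP i.
  pose g (z : tup M (sum_sort (sum_sort sg tg) ug)) :=
    join_tup (join_tup (ltup (ltup z)) (rtup z)) (rtup (ltup z)).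
  have rg : reindexing g by reindex.
  exists [set z | exists y, (g @^-1` T) (join_tup z y)].
    exact: definable_ex (definable_preimage rg dT).
  by move=> x; split=> -[y hy]; exists y; apply/PT.
move=> x; split=> [[y Sy] i|h]; first by exists y; apply SP.
have [|l|y hy] := @def_compact _ ug _ _ (join_tup b x) I
  (fun i => [set y | P i (join_tup x y)]) sW (small_sum hK sB sV).
- move=> i; pose g (z : tup M (sum_sort ug sg)) := join_tup (rtup z) (ltup z).
  have rg : reindexing g by reindex.
  exact: (def_over_fix x (def_over_preimage rg (dP i))).
- have [k hk] := directed_list l i0 dir; have [y Py] := h k.
  by exists y => i /hk; exact.
by exists y; apply/SP.
Qed.

End TypeDefinable.

(** * Products of k_omega spaces *)

(** If [Pr A] failed, the sets [B] with [Pr] of the difference of [A] and [B] would form a proper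
    filter; the local hypothesis at a cluster point in [A] refutes this. *)
Lemma compact_ind (T : topologicalType) (A : set T) (Pr : set T -> Prop) :
  compact A -> (forall B C, B `<=` C -> Pr C -> Pr B) -> Pr set0 ->
  (forall B C, Pr B -> Pr C -> Pr (B `|` C)) ->
  (forall x, A x -> exists2 U, open U /\ U x & Pr U) -> Pr A.
Proof.
move=> cA sub P0 PU loc; apply: contrapT => nPA.
pose F : set_system T := [set B | Pr (A `\` B)].
have FF : ProperFilter F.
  split; first by rewrite /F /= setD0.
  split; first by rewrite /F /= setDT.
    by move=> B C; rewrite /F /= setDIr => PB PC; exact: PU.
  by move=> B C BC; apply: sub; exact: setDS.
have [|x [Ax clx]] := cA F FF; first by rewrite /F /= setDv.
have [U [oU Ux] PrU] := loc x Ax.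
have [||y [nUy Uy]] := clx (~` U) U; last by [].
  by rewrite /F /= setDE setCK; apply: sub PrU; exact: subIsetr.
exact: open_nbhs_nbhs.
Qed.

Section Boxes.
Variable T : topologicalType.
Implicit Types (W : set (T * T)) (Q A B : set T).

(* [A * B] has a neighbourhood whose trace on [Q * Q] lies in a product of closed
   sets contained in [W]. *)
Definition box W Q A B := exists U V F H : set T,
  [/\ [/\ open U, A `<=` U, closed F, U `&` Q `<=` F & F `<=` Q],
      [/\ open V, B `<=` V, closed H, V `&` Q `<=` H & H `<=` Q] &
      forall x y, F x -> H y -> W (x, y)].

Definition swap W : set (T * T) := [set p | W (p.2, p.1)].

Lemma box_swap W Q A B : box W Q A B -> box (swap W) Q B A.
Proof.
move=> [U [V [F [H [hU hV hW]]]]]; exists V, U, H, F; split=> // x y Hx Fy.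
exact: hW.
Qed.

Lemma box_sub W Q A A' B B' : A' `<=` A -> B' `<=` B -> box W Q A B -> box W Q A' B'.
Proof.
move=> AA BB [U [V [F [H [[oU AU cF UF FQ] [oV BV cH VH HQ] hW]]]]].
by exists U, V, F, H; split=> //; split=> //; [exact: subset_trans AU|exact: subset_trans BV].
Qed.

Lemma box_open W Q A B : box W Q A B -> exists2 U, open U /\ A `<=` U & box W Q U B.
Proof.
move=> [U [V [F [H [[oU AU cF UF FQ] hV hW]]]]].
exists U; first by split.
by exists U, V, F, H; split=> //; split.
Qed.

Lemma box_setUl W Q A A' B : box W Q A B -> box W Q A' B -> box W Q (A `|` A') B.
Proof.
move=> [U [V [F [H [[oU AU cF UF FQ] [oV BV cH VH HQ] hW]]]]].
move=> [U' [V' [F' [H' [[oU' AU' cF' UF' FQ'] [oV' BV' cH' VH' HQ'] hW']]]]].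
exists (U `|` U'), (V `&` V'), (F `|` F'), (H `&` H'); split.
- split; [exact: openU|exact: setUSS|exact: closedU| |].
    by rewrite setIUl; exact: setUSS.
  by rewrite subUset.
- split; [exact: openI|by rewrite subsetI|exact: closedI| |].
    by move=> x [[Vx V'x] Qx]; split; [exact: VH|exact: VH'].
  by move=> x [/HQ].
by move=> x y [Fx|F'x] [Hy H'y]; [exact: hW|exact: hW'].
Qed.

Lemma box_set0 W Q B : B `<=` Q -> closed Q -> box W Q set0 B.
Proof.
move=> BQ cQ; exists set0, setT, set0, Q; split=> //.
- by split; rewrite ?set0I //; [exact: open0|exact: closed0].
- by split; rewrite ?setTI //; exact: openT.
Qed.

Lemma box_compact_pt W Q A y : closed Q -> Q y -> compact A ->
  (forall x, A x -> box W Q [set x] [set y]) -> box W Q A [set y].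
Proof.
move=> cQ Qy cA loc; apply: (compact_ind (Pr := fun A => box W Q A [set y])) cA _ _ _ _.
- by move=> B C BC; exact: box_sub.
- by apply: box_set0 => // _ ->.
- by move=> B C; exact: box_setUl.
by move=> x /loc/box_open[U [oU sU] bU]; exists U => //; split=> //; exact: sU.
Qed.

(** The tube lemma, used in one coordinate over a point of the other and then, through [swap], in
    the other coordinate. *)
Lemma box_compact W Q A B : closed Q -> A `<=` Q -> B `<=` Q ->
  compact A -> compact B ->
  (forall x y, A x -> B y -> box W Q [set x] [set y]) -> box W Q A B.
Proof.
move=> cQ AQ BQ cA cB loc; apply: (@box_swap (swap W)).
apply: (compact_ind (Pr := fun B => box (swap W) Q B A)) cB _ _ _ _.
- by move=> C D CD; exact: box_sub.
- exact: box_set0.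
- by move=> C D; exact: box_setUl.
move=> y By; have [|U [oU sU] bU] := @box_open (swap W) Q [set y] A.
  by apply: box_swap; apply: box_compact_pt => // [|x Ax]; [exact: BQ|exact: loc].
by exists U => //; split=> //; exact: sU.
Qed.

Variable Q : nat -> set T.
Hypotheses (cptQ : forall n, compact (Q n)) (clQ : forall n, closed (Q n)).
Hypothesis incrQ : forall n, Q n `<=` Q n.+1.
Hypothesis weakQ : forall C : set T, (forall n, closed (C `&` Q n)) -> closed C.

Lemma incrQ_le m n : (m <= n)%N -> Q m `<=` Q n.
Proof.
move=> /subnK <-; elim: (n - m)%N => // k IH; rewrite addSn.
exact: subset_trans IH (@incrQ _).
Qed.

(** Inside [Q m] the union of the [F n] equals that of the open sets [O n] with [m <= n], because
    there [O n] lies in [F n.+1]. So the complement has closed traces and [weakQ] applies. *)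
Lemma open_bigcup_chain (F O : nat -> set T) : (forall n, F n `<=` Q n) ->
  (forall n, open (O n)) -> (forall n, F n `<=` O n) ->
  (forall n, O n `&` Q n.+1 `<=` F n.+1) -> open (\bigcup_n F n).
Proof.
move=> FQ oO FO OF; have Fle m n : (m <= n)%N -> F m `<=` F n.
  move=> /subnK <-; elim: (n - m)%N => // k IH; rewrite addSn => x Fx.
  have Fk := IH _ Fx; apply: OF; split; first exact: FO.
  by apply: incrQ; exact: FQ.
rewrite -closedC; apply: weakQ => m.
rewrite (_ : _ `&` _ = ~` (\bigcup_(n in [set n | (m <= n)%N]) O n) `&` Q m).
  by apply: closedI => //; apply: open_closedC; apply: bigcup_open.
apply/seteqP; split=> x [nx Qx]; split=> // -[n].
  move=> /= mn Ox; apply: nx; exists n.+1 => //; apply: OF; split=> //.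
  by apply: incrQ_le Qx; exact: leqW.
move=> _ Fx; apply: nx; exists (maxn m n); first exact: leq_maxl.
by apply: FO; apply: Fle Fx; exact: leq_maxr.
Qed.

(* Starting from a point of [W], grow products of compact sets inside [W], each
   in the interior of the next relative to [Q]; their union is open. *)
Lemma komega_box W x y :
  (forall n a b, Q n a -> Q n b -> W (a, b) -> box W (Q n) [set a] [set b]) ->
  Q 0 x -> Q 0 y -> W (x, y) ->
  exists U V, [/\ open U /\ open V, U x, V y & forall a b, U a -> V b -> W (a, b)].
Proof.
move=> loc Qx Qy Wxy.
pose ok n (p : set T * set T) := [/\ closed p.1 /\ closed p.2,
  p.1 `<=` Q n /\ p.2 `<=` Q n & forall a b, p.1 a -> p.2 b -> W (a, b)].
pose grow n (A B : set T) := exists O, open O /\ A `<=` O /\ O `&` Q n `<=` B.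
(* [ok n p] stands under the existential so that choice yields a total step function; elsewhere [p]
   is a dummy value. *)
have stepP n p : exists p', ok n p ->
    [/\ ok n.+1 p', grow n.+1 p.1 p'.1 & grow n.+1 p.2 p'.2].
  have [[[c1 c2] [s1 s2] pW]|nok] := pselect (ok n p); last by exists p.
  have q1 : p.1 `<=` Q n.+1 := subset_trans s1 (@incrQ n).
  have q2 : p.2 `<=` Q n.+1 := subset_trans s2 (@incrQ n).
  have [|U [V [F [H [[oU AU cF UF FQ] [oV BV cH VH HQ] hW]]]]] :=
    @box_compact W (Q n.+1) p.1 p.2 (@clQ n.+1) q1 q2 (subclosed_compact c1 (@cptQ n.+1) q1)
      (subclosed_compact c2 (@cptQ n.+1) q2).
    by move=> a b pa pb; apply: loc; [exact: q1|exact: q2|exact: pW].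
  by exists (F, H) => _; split=> //; [exists U|exists V].
pose s n := projT1 (choice (stepP n)).
have hs n := projT2 (choice (stepP n)).
have [U [V [F [H [[oU AU cF UF FQ] [oV BV cH VH HQ] hW]]]]] := loc 0%N x y Qx Qy Wxy.
pose c := fix c n := if n is m.+1 then s m (c m) else (F, H).
have okc n : ok n (c n) by elim: n => [//|n /(hs n)[]].
have g1 n : grow n.+1 (c n).1 (c n.+1).1 by have [] := hs n _ (okc n).
have g2 n : grow n.+1 (c n).2 (c n.+1).2 by have [] := hs n _ (okc n).
have cle m n : (m <= n)%N -> (c m).1 `<=` (c n).1 /\ (c m).2 `<=` (c n).2.
  move=> /subnK <-; elim: (n - m)%N => [|k [IH1 IH2]]; first by split.
  rewrite addSn.
  have [_ [/subset_trans s1 /subset_trans s2] _] := okc (k + m)%N.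
  have [O1 [_ [a1 b1]]] := g1 (k + m)%N; have [O2 [_ [a2 b2]]] := g2 (k + m)%N.
  split=> z /[dup] cz.
    move=> /IH1 cz1; apply: b1; split; first exact: a1.
    by apply: s1 cz1; exact: incrQ.
  move=> /IH2 cz2; apply: b2; split; first exact: a2.
  by apply: s2 cz2; exact: incrQ.
exists (\bigcup_n (c n).1), (\bigcup_n (c n).2); split.
- have [O1 hO1] := choice g1; have [O2 hO2] := choice g2.
  split; [apply: (@open_bigcup_chain _ O1)|apply: (@open_bigcup_chain _ O2)] => n.
  + by have [_ []] := okc n.
  + by have [] := hO1 n.
  + by have [_ []] := hO1 n.
  + by have [_ []] := hO1 n.
  + by have [_ []] := okc n.
  + by have [] := hO2 n.
  + by have [_ []] := hO2 n.
  + by have [_ []] := hO2 n.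
- by exists 0%N => //; apply: UF; split=> //; exact: AU.
- by exists 0%N => //; apply: VH; split=> //; exact: BV.
move=> a b [m _ ca] [n _ cb]; have [_ _] := okc (maxn m n); apply.
  by apply: (cle _ _ (leq_maxl m n)).1.
by apply: (cle _ _ (leq_maxr m n)).2.
Qed.

End Boxes.

(** * The global logic topology *)

Section LogicTopology.
Variables (K : Type) (L : language) (M : structure L).
Hypotheses (hK : strong_limit K) (hL : language_small K L) (hsat : saturated K M).
Variables (P : Type) (D : pw_presentation M P) (A : parameters M).
Hypothesis hD : pw_hyperdefinable K A D.

Notation sm T := (small K [set: T]).
Notation TD := (type_definable K).
Notation X i := (qdom (pw_pres i)).
Notation vs i := (idx_sort (pw_pres i)).

Definition proj (i : pw_idx D) (z : tup M (vs i)) : P :=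
  pw_incl i (qproj (pw_pres i) z).

Definition piece_set (i : pw_idx D) : set P := @proj i @` X i.

Lemma hyperdef_piece (i : pw_idx D) : hyperdefinable K A (pw_pres i).
Proof. by have [_ _] := hD. Qed.

Lemma small_idx (i : pw_idx D) : sm (idx (pw_pres i)).
Proof. by have [[]] := hyperdef_piece i. Qed.

Lemma td_qdom (i : pw_idx D) : TD (X i).
Proof. by have [_ []] := hyperdef_piece i. Qed.

Lemma qproj_surj (i : pw_idx D) (x : piece D i) :
  exists2 z, X i z & qproj (pw_pres i) z = x.
Proof.
have [[_ _ e] _ _] := hyperdef_piece i.
have : [set: piece D i] x by [].
by rewrite -e => -[z]; exists z.
Qed.

Lemma pw_incl_trans (i j : pw_idx D) (hij : pw_le D i j) (x : piece D i) :
  pw_incl j (pw_trans hij x) = pw_incl i x.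
Proof. by have [_ _ _ _ [_ + _]] := hD; apply. Qed.

(** Points identified in the limit are identified at some later stage, and transition maps are
    injective. *)
Lemma pw_incl_inj (i : pw_idx D) : injective (@pw_incl _ _ _ D i).
Proof.
have [_ _ _ [_ _ inj] [_ _ lim]] := hD => x y /lim[k [h1 [h2 e]]].
by apply: (inj _ _ h1).1; rewrite e (Prop_irrelevance h1 h2).
Qed.

Lemma piece_set_le (i j : pw_idx D) : pw_le D i j -> piece_set i `<=` piece_set j.
Proof.
move=> hij _ [z Xz <-]; have [w Xw e] := qproj_surj (pw_trans hij (qproj (pw_pres i) z)).
by exists w => //; rewrite /proj e pw_incl_trans.
Qed.

Lemma piece_set_range (i : pw_idx D) : piece_set i = range (@pw_incl _ _ _ D i).
Proof.
apply/seteqP; split=> [_ [z _ <-]|_ [x _ <-]]; first by exists (qproj (pw_pres i) z).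
by have [z Xz <-] := qproj_surj x; exists z.
Qed.

Lemma piece_set_cover (x : P) : exists i, piece_set i x.
Proof.
have [_ _ _ _ [cov _ _]] := hD; have [i [y <-]] := cov x.
by exists i; rewrite piece_set_range; exists y.
Qed.

(** For [i = j] this is the equivalence relation defining the piece; in general it is equality in
    the limit, read on representatives. *)
Definition kernel (i j : pw_idx D) : set (tup M (sum_sort (vs i) (vs j))) :=
  [set z | [/\ X i (ltup z), X j (rtup z) & proj (ltup z) = proj (rtup z)]].

Arguments kernel i j z : clear implicits.

(** Equality is tested in a common upper piece [k]: two points agree when the graphs of the
    transition maps give them a common image there, and this image is projected away. *)
Lemma td_kernel (i j : pw_idx D) : TD (kernel i j).
Proof.
have [[_ _ _ dir] _ _ [_ _ tr] _] := hD; have [k [hik hjk]] := dir i j.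
have [_ [ti _]] := tr i k hik; have [_ [tj _]] := tr j k hjk.
pose gi (z : tup M (sum_sort (sum_sort (vs i) (vs j)) (vs k))) :=
  join_tup (ltup (ltup z)) (rtup z).
pose gj (z : tup M (sum_sort (sum_sort (vs i) (vs j)) (vs k))) :=
  join_tup (rtup (ltup z)) (rtup z).
have ri : reindexing gi by reindex.
have rj : reindexing gj by reindex.
have si := small_idx i; have sj := small_idx j; have sk := small_idx k.
have sij := small_sum hK si sj; have sijk := small_sum hK sij sk.
have t := td_ex hK hL hsat sij sk (td_setI hK hL sijk
  (td_preimage hK hL (small_sum hK si sk) ri ti)
  (td_preimage hK hL (small_sum hK sj sk) rj tj)).
apply: td_iff t => z; split=> [[w [[[Xi Xk] ei] [[Xj _] ej]]]|[Xi Xj e]].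
  split=> //; rewrite /proj -(pw_incl_trans hik) -(pw_incl_trans hjk).
  by congr pw_incl; rewrite /graph /= in ei ej; rewrite ei ej.
have [w Xw ew] := qproj_surj (pw_trans hik (qproj (pw_pres i) (ltup z))).
exists w; split; split; [by split|exact: esym ew|by split|apply: (@pw_incl_inj k)].
change (pw_incl k (pw_trans hjk (qproj (pw_pres j) (rtup z))) =
        pw_incl k (qproj (pw_pres k) w)).
by rewrite ew !pw_incl_trans; exact: esym e.
Qed.

Variable tau : topology_on P.
Hypotheses (htau : is_logic_topology K A D tau) (hT1 : accessible_space (top_space tau)).

Notation T := (top_space tau).

(* The [A]-invariance of a closed set is automatic, since points are closed. *)
Lemma closed_td (C : set P) :
  closed (C : set T) <-> forall i, TD (X i `&` @proj i @^-1` C).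
Proof.
split=> [/htau h i|h]; first exact: (h i).1.
apply/htau => i; split; first exact: h.
move=> f fixf z [Xz Cz].
have /htau/(_ i)[_ inv] := @accessible_closed_set1 T hT1 (proj z).
have [|X' e] := inv f fixf z; first by split.
by split=> //; rewrite /preimage /= in e *; rewrite e.
Qed.

(** The trace on the piece [j] is the projection of the part of [kernel j i] lying over [S]. *)
Lemma closed_image (i : pw_idx D) (S : set (tup M (vs i))) :
  TD S -> S `<=` X i -> closed (@proj i @` S : set T).
Proof.
move=> tS SX; apply/closed_td => j.
have si := small_idx i; have sj := small_idx j; have sji := small_sum hK sj si.
have rr : reindexing (@rtup L M _ _ (vs j) (vs i)) by reindex.
have t := td_ex hK hL hsat sj si (td_setI hK hL sji (td_kernel j i)
  (td_preimage hK hL si rr tS)).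
apply: td_iff t => z; split=> [[w [[Xz Xw e] Sw]]|[Xz [w Sw e]]].
  by split=> //; exists w.
by exists w; split=> //; split=> //; exact: SX.
Qed.

Lemma closed_piece (i : pw_idx D) : closed (piece_set i : set T).
Proof. exact: closed_image (td_qdom i) (@subset_refl _ _). Qed.

(** * Uniform structure and compactness of a single piece *)

Section Piece.
Variable i : pw_idx D.
Variables (B : Type) (tg : B -> lsort L) (b : tup M tg) (J : Type).
Variable R : J -> set (tup M (sum_sort (vs i) (vs i))).
Hypotheses (sB : sm B) (sJ : sm J) (dR : forall t, def_over b (R t)).
Hypothesis RE : forall z, kernel i i z <-> forall t, R t z.
Hypotheses (J0 : inhabited J)
  (dirR : forall s t, exists u, forall x, R u x -> R s x /\ R t x).

Let sX : sm (idx (pw_pres i)) := small_idx i.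

Lemma kernel_ent a z t : X i a -> X i z -> proj a = proj z -> R t (join_tup a z).
Proof. by move=> Xa Xz e; move: t; apply/RE. Qed.

Lemma def_ball (a : tup M (vs i)) t :
  def_over (join_tup b a) [set z | R t (join_tup a z)].
Proof.
pose g (z : tup M (sum_sort (vs i) (vs i))) := join_tup (rtup z) (ltup z).
have rg : reindexing g by reindex.
exact: (def_over_fix a (def_over_preimage rg (dR t))).
Qed.

Lemma td_ball (a : tup M (vs i)) t : TD (X i `&` [set z | R t (join_tup a z)]).
Proof.
apply: td_setI => //; first exact: td_qdom.
exact: td_def (small_sum hK sB sX) (def_ball a t).
Qed.

(** The points none of whose representatives leaves the [R t] ball of [a]; points outside the piece
    belong to it. *)
Definition open_ball (a : tup M (vs i)) t : set T :=
  ~` (@proj i @` (X i `&` ~` [set z | R t (join_tup a z)])).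

Lemma open_ballP (a : tup M (vs i)) t : open (open_ball a t).
Proof.
apply: closed_openC; apply: closed_image => [|z []//].
apply: td_setI => //; first exact: td_qdom.
exact: td_def (small_sum hK sB sX) (def_over_setC (def_ball a t)).
Qed.

Lemma open_ball_center a t : X i a -> open_ball a t (proj a).
Proof. by move=> Xa [z [Xz nR] e]; apply: nR; exact: kernel_ent. Qed.

Lemma open_ball_sub a t z : X i z -> open_ball a t (proj z) -> R t (join_tup a z).
Proof. by move=> Xz h; apply: contrapT => nR; apply: h; exists z. Qed.

(** Symmetry and transitivity of [E] in approximate form. If every [u] failed, compactness would
    produce [z0] equivalent to [z1] and to [z2] with [R t] false at [z1], [z2]. *)
Lemma ent_comp t : exists u, forall z0 z1 z2, X i z0 -> X i z1 -> X i z2 ->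
  R u (join_tup z0 z1) -> R u (join_tup z0 z2) -> R t (join_tup z1 z2).
Proof.
apply: contrapT => /forallNP h.
pose sg3 := sum_sort (sum_sort (vs i) (vs i)) (vs i).
pose p0 (z : tup M sg3) := ltup (ltup z).
pose p1 (z : tup M sg3) := rtup (ltup z).
pose p2 (z : tup M sg3) := rtup z.
pose p01 (z : tup M sg3) := join_tup (p0 z) (p1 z).
pose p02 (z : tup M sg3) := join_tup (p0 z) (p2 z).
pose p12 (z : tup M sg3) := join_tup (p1 z) (p2 z).
have r0 : reindexing p0 by reindex.
have r1 : reindexing p1 by reindex.
have r2 : reindexing p2 by reindex.
have r01 : reindexing p01 by reindex.
have r02 : reindexing p02 by reindex.
have r12 : reindexing p12 by reindex.
have s3 := small_sum hK (small_sum hK sX sX) sX.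
have tX := td_qdom i.
have [|||u|z] := @td_compact _ _ _ hK hL hsat _ sg3 _ _ b J
  (fun u => (p01 @^-1` R u `&` p02 @^-1` R u) `&` ~` (p12 @^-1` R t))
  (p0 @^-1` X i `&` p1 @^-1` X i `&` p2 @^-1` X i) s3 sB _ _ J0.
- apply: td_setI => //; first apply: td_setI => //.
  + exact: td_preimage r0 tX.
  + exact: td_preimage r1 tX.
  + exact: td_preimage r2 tX.
- move=> u; apply: def_over_setI; last exact/def_over_setC/def_over_preimage.
  by apply: def_over_setI; exact: def_over_preimage.
- move=> u v; have [w hw] := dirR u v; exists w => z [[/hw[? ?] /hw[? ?]] ?].
  by split; split.
- have /existsNP[z0 /existsNP[z1 /existsNP[z2]]] := h u.
  move=> /not_implyP[X0 /not_implyP[X1 /not_implyP[X2 /not_implyP[R1 /not_implyP[R2 nR]]]]].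
  by exists (join_tup (join_tup z0 z1) z2).
move=> [[X0 X1] X2] hz; have [_ nR] := hz t; apply: nR.
have /RE[_ _ e1] : forall u, R u (p01 z) by move=> u; have [[]] := hz u.
have /RE[_ _ e2] : forall u, R u (p02 z) by move=> u; have [[]] := hz u.
by apply: kernel_ent => //; rewrite -[LHS]e1 -[RHS]e2.
Qed.

(* Otherwise an [R t]-separated sequence projects onto a closed discrete set, whose
   preimage is type-definable and contains the sequence but no further class. *)
Lemma totally_bounded t : exists l : seq (tup M (vs i)),
  (forall a, List.In a l -> X i a) /\
  forall z, X i z -> exists2 a, List.In a l & R t (join_tup a z).
Proof.
apply: contrapT => /forallNP h.
have next l : exists z, (forall a, List.In a l -> X i a) ->
    X i z /\ forall a, List.In a l -> ~ R t (join_tup a z).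
  have [lX|nlX] := pselect (forall a, List.In a l -> X i a); last first.
    by have [z0] := tup_inh M (vs i); exists z0.
  have /not_andP[//|/existsNP[z /not_implyP[Xz nz]]] := h l.
  by exists z => _; split=> // a al Rz; apply: nz; exists a.
have [f hf] := choice next.
pose l := fix l n := if n is m.+1 then f (l m) :: l m else [::].
have lX n a : List.In a (l n) -> X i a.
  elim: n a => [//|n IH] a /= [<-|/IH//].
  by have [] := hf (l n) IH.
pose a n := f (l n); have Xa n : X i (a n) by have [] := hf (l n) (lX n).
have la m n : (m < n)%N -> List.In (a m) (l n).
  elim: n => [//|n IH]; rewrite ltnS leq_eqVlt => /orP[/eqP ->|/IH]; first by left.
  by right.
have sep m n : (m < n)%N -> ~ R t (join_tup (a m) (a n)).
  by move=> mn; have [_] := hf (l n) (lX n); apply; exact: la.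
have [u hu] := ent_comp t.
pose C : set T := [set proj (a n) | n in setT].
have clC : closed C.
  rewrite -openC openE => p nCp.
  have [[z Xz zp]|nQ] := pselect (piece_set i p); last first.
    have nbp : open_nbhs p (~` (piece_set i : set T)).
      by split=> //; apply: closed_openC; exact: closed_piece.
    apply: filterS (open_nbhs_nbhs nbp) => y nQy [n _ e].
    by apply: nQy; exists (a n).
  have nbz : open_nbhs p (open_ball z u).
    by split; [exact: open_ballP|rewrite -zp; exact: open_ball_center].
  (* By the choice of [u], two terms in this ball would be [R t]-close; so each point has a
     neighbourhood containing at most one term. *)
  have uniq_ball m n : open_ball z u (proj (a m)) -> open_ball z u (proj (a n)) -> m = n.
    move=> /(open_ball_sub (Xa m)) Rm /(open_ball_sub (Xa n)) Rn.
    have [mn|nm|//] := ltngtP m n.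
      by case: (sep _ _ mn); exact: (hu z _ _ Xz (Xa m) (Xa n)).
    by case: (sep _ _ nm); exact: (hu z _ _ Xz (Xa n) (Xa m)).
  have [[m um]|/forallNP nU] := pselect (exists m, open_ball z u (proj (a m))).
    have nbm : open_nbhs p (open_ball z u `&` ~` [set proj (a m)]).
      split; last by split; [exact: nbz.2|move=> e; apply: nCp; exists m].
      by apply: openI; [exact: nbz.1|apply/closed_openC/(accessible_closed_set1 hT1)].
    apply: filterS (open_nbhs_nbhs nbm) => y [Uy ny] [n _ e]; apply: ny.
    by rewrite -e (uniq_ball n m) // e.
  apply: filterS (open_nbhs_nbhs nbz) => y Uy [n _ e].
  by apply: (nU n); rewrite e.
have tS := (closed_td C).1 clC i.
pose sga (p : nat * idx (pw_pres i)) := vs i p.2.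
pose c : tup M sga := fun p => a p.1 p.2.
have sN : sm nat by apply: (small_inj (f := inr)) hL => ? ? [].
have da n : def_over (join_tup b c) [set z | ~ R t (join_tup (a n) z)].
  apply: def_over_setC; apply: def_over_weaken (def_ball (a n) t).
  instantiate (1 := fun w => match w with inl w => inl w | inr v => inr (n, v) end).
  by case.
(* The term [a n] satisfies the first [n] conditions. A solution of all of them would be far from
   every term and yet in the class of one. *)
have [n||m n|n|z [Xz [n _ e]] hz] := @td_compact _ _ _ hK hL hsat _ _ _ _ (join_tup b c) nat
  (fun n => [set z | forall m, List.In m (iota 0 n) -> ~ R t (join_tup (a m) z)])
  _ sX (small_sum hK sB (small_prod hK sN sX)) tS.
- exact: def_over_list.
- by split; exact: 0%N.
- exists (maxn m n) => z hz; split=> k /In_mem; rewrite mem_iota => /andP[_ kn];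
    apply: hz; apply/In_mem; rewrite mem_iota /= add0n leq_max.
    by rewrite kn.
  by rewrite kn orbT.
- exists (a n); first by split=> //; exists n.
  by move=> m /In_mem; rewrite mem_iota => /andP[_]; exact: sep.
apply: (hz n.+1 n); last exact: kernel_ent.
by apply/In_mem; rewrite mem_iota /= add0n.
Qed.

(** An ultrafilter contains a ball from each finite cover. The chosen balls, one for each [t], have
    the finite intersection property, so some [z] lies in all of them, and the ultrafilter converges
    to its class. *)
Lemma compact_piece : compact (piece_set i : set T).
Proof.
rewrite compact_ultra => F UF FQ.
(* Fixed representatives, since membership in an [R t] ball can depend on the representative. *)
have [r hr] : exists r : P -> tup M (vs i), forall p, piece_set i p ->
    X i (r p) /\ proj (r p) = p.
  apply: (dep_choice (P := fun p z => piece_set i p -> X i z /\ proj z = p)) => p.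
  have [[z Xz zp]|nQ] := pselect (piece_set i p); first by exists z.
  by have [z0] := tup_inh M (vs i); exists z0.
have [a ha] : exists a : J -> tup M (vs i), forall t,
    X i (a t) /\ F [set p | piece_set i p /\ R t (join_tup (a t) (r p))].
  apply: (dep_choice (P := fun t a => X i a /\
    F [set p | piece_set i p /\ R t (join_tup a (r p))])) => t.
  have [l [lX cov]] := totally_bounded t; apply: contrapT => /forallNP h.
  have : F (piece_set i `&` [set p | forall a, List.In a l -> ~ R t (join_tup a (r p))]).
    elim: l lX {cov} => [|a l IH] lX.
      by apply: filterS FQ => p Qp; split.
    have [Fa|nFa] := in_ultra_setVsetC
      [set p | piece_set i p /\ R t (join_tup a (r p))] UF.
      by case: (h a); split=> //; apply: lX; left.
    apply: filterS (filterI nFa (IH (fun a al => lX a (or_intror al)))).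
    move=> p [na [Qp nl]]; split=> // a' [<- Ra|]; last exact: nl.
    by apply: na.
  move=> /filter_ex[p [Qp np]]; have [Xr _] := hr p Qp.
  by have [a' al Ra] := cov _ Xr; exact: np al Ra.
pose sga (p : J * idx (pw_pres i)) := vs i p.2.
pose c : tup M sga := fun p => a p.1 p.2.
have [B0 [tg0 [b0 [J1 [R1 [[sB0 _] dR1 XR1 _ _]]]]]] := td_family hK hL sX (td_qdom i).
have [z hz] : exists z, forall s : J + J1, (match s with
    | inl t => [set z | R t (join_tup (a t) z)] | inr t => R1 t end : set _) z.
  apply: (def_compact hK hsat (b := join_tup (join_tup b c) b0)) => //.
  - by do !apply: small_sum => //; exact: small_prod.
  - move=> [t|t]; last exact: def_over_join_r.
    apply: def_over_join_l; apply: def_over_weaken (def_ball (a t) t).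
    instantiate (1 := fun w => match w with inl w => inl w | inr v => inr (t, v) end).
    by case.
  move=> l; have : F (piece_set i `&` [set p | forall t, List.In (inl t) l -> R t (join_tup (a t) (r p))]).
    elim: l => [|[t|t] l IH]; first by apply: filterS FQ => p Qp; split.
      apply: filterS (filterI (ha t).2 IH) => p [[Qp Rp] [_ hp]]; split=> // t' [[<-]//|].
      exact: hp.
    by apply: filterS IH => p [Qp hp]; split=> // t' [//|]; exact: hp.
  move=> /filter_ex[p [Qp hp]]; exists (r p) => -[t|t]; first exact: hp.
  by move=> _; apply/XR1: t; exact: (hr p Qp).1.
have Xz : X i z by apply/XR1 => t; exact: (hz (inr t)).
exists (proj z); split; first by exists z.
move=> O; rewrite nbhsE => -[U [oU Uz] UO].
have tS := (closed_td (~` U)).1 (open_closedC oU) i.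
(* By compactness, a neighbourhood of the class of [z] contains the image of a whole ball around
   [z]. *)
have [t ht] : exists t, forall w, X i w -> R t (join_tup z w) -> U (proj w).
  apply: contrapT => /forallNP h.
  have [||w [Xw nU] hw] := @td_compact _ _ _ hK hL hsat _ _ _ _ (join_tup b z) J
    (fun t => [set w | R t (join_tup z w)]) _ sX (small_sum hK sB sX) tS (def_ball z) J0.
  - by move=> s t; have [u hu] := dirR s t; exists u => x /hu.
  - move=> t; have /existsNP[w /not_implyP[Xw /not_implyP[Rw nU]]] := h t.
    by exists w.
  apply: nU; have /RE[_ _ e] := hw; suff <- : proj z = proj w by [].
  exact: e.
(* Both [z] and [r p] are [R u]-close to the centre [a u], hence [R t]-close to each other. *)
have [u hu] := ent_comp t; apply: filterS (ha u).2 => p [Qp Rp]; apply: UO.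
have [Xr <-] := hr p Qp; apply: ht => //.
by apply: (hu (a u)) => //; [exact: (ha u).1|exact: (hz (inl u))].
Qed.

(** Compactness gives one [t] whose balls around representatives of [x] and [y] have product
    disjoint from [N]. The images of these balls are the closed factors, the corresponding
    [open_ball]s the open ones. *)
Lemma box_piece (N : set (P * P)) x y :
  TD [set z : tup M (sum_sort (vs i) (vs i)) | [/\ X i (ltup z), X i (rtup z) &
    N (proj (ltup z), proj (rtup z))]] ->
  piece_set i x -> piece_set i y -> ~ N (x, y) ->
  box (~` N : set (T * T)) (piece_set i) [set x] [set y].
Proof.
move=> tN [a Xa <-] [a' Xa' <-] nN.
have sXX := small_sum hK sX sX.
have [t ht] : exists t, forall z z', X i z -> X i z' ->
    R t (join_tup a z) -> R t (join_tup a' z') -> ~ N (proj z, proj z').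
  apply: contrapT => /forallNP h.
  have rl : reindexing (@ltup L M _ _ (vs i) (vs i)) by reindex.
  have rr : reindexing (@rtup L M _ _ (vs i) (vs i)) by reindex.
  have [||t|w [Xz Xz' Nw] hw] := @td_compact _ _ _ hK hL hsat _ _ _ _
    (join_tup (join_tup b a) (join_tup b a')) J
    (fun t => [set w | R t (join_tup a (ltup w)) /\ R t (join_tup a' (rtup w))])
    _ sXX (small_sum hK (small_sum hK sB sX) (small_sum hK sB sX)) tN _ J0.
  - move=> t; apply: def_over_setI.
      exact: (def_over_join_l _ (def_over_preimage rl (def_ball a t))).
    exact: (def_over_join_r _ (def_over_preimage rr (def_ball a' t))).
  - move=> s t; have [u hu] := dirR s t.
    by exists u => w [/hu[? ?] /hu[? ?]].
  - have /existsNP[z /existsNP[z' /not_implyP[Xz /not_implyP[Xz']]]] := h t.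
    move=> /not_implyP[Rz /not_implyP[Rz' /contrapT Nz]].
    by exists (join_tup z z').
  apply: nN; have /RE[_ _ e] : forall t, R t (join_tup a (ltup w)) by move=> t; case: (hw t).
  have /RE[_ _ e'] : forall t, R t (join_tup a' (rtup w)) by move=> t; case: (hw t).
  have -> : proj a = proj (ltup w) by [].
  by have -> : proj a' = proj (rtup w) by [].
pose ball a := @proj i @` (X i `&` [set z | R t (join_tup a z)]).
have ballP c : X i c -> [/\ open (open_ball c t), [set proj c] `<=` open_ball c t,
    closed (ball c : set T), open_ball c t `&` piece_set i `<=` ball c &
    ball c `<=` piece_set i].
  move=> Xc; split.
  - exact: open_ballP.
  - by move=> p ->; exact: open_ball_center.
  - by apply: closed_image (td_ball c t) _ => z [].
  - move=> p [oz [z Xz e]]; rewrite -e in oz *.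
    by exists z => //; split=> //; exact: open_ball_sub oz.
  by move=> _ [z [Xz _] <-]; exists z.
exists (open_ball a t), (open_ball a' t), (ball a), (ball a').
split; [exact: ballP|exact: ballP|].
by move=> _ _ [z [Xz Rz] <-] [z' [Xz' Rz'] <-]; exact: ht.
Qed.

End Piece.

Lemma piece_set_compact (i : pw_idx D) : compact (piece_set i : set T).
Proof.
have sX := small_idx i.
have [B [tg [b [J [R [[sB sJ] dR RE J0 dirR]]]]]] :=
  td_family hK hL (small_sum hK sX sX) (td_kernel i i).
exact: (compact_piece sB sJ dR RE J0 dirR).
Qed.

Lemma piece_set_box (i : pw_idx D) (N : set (P * P)) x y :
  TD [set z : tup M (sum_sort (vs i) (vs i)) | [/\ X i (ltup z), X i (rtup z) &
    N (proj (ltup z), proj (rtup z))]] ->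
  piece_set i x -> piece_set i y -> ~ N (x, y) ->
  box (~` N : set (T * T)) (piece_set i) [set x] [set y].
Proof.
have sX := small_idx i.
have [B [tg [b [J [R [[sB sJ] dR RE J0 dirR]]]]]] :=
  td_family hK hL (small_sum hK sX sX) (td_kernel i i).
exact: (box_piece sB dR RE J0 dirR).
Qed.

(** * From the pieces to the direct limit and its square *)

Hypothesis hcount : countable_cofinality D.

(** Each term bounds its predecessor and one more element of an enumerated cofinal set. The free
    start [j0] allows two given points to lie in the first piece. *)
Lemma cofinal_chain (j0 : pw_idx D) : exists c : nat -> pw_idx D,
  [/\ c 0%N = j0, forall n, pw_le D (c n) (c n.+1) & forall j, exists n, pw_le D j (c n)].
Proof.
have [[_ refl trans dir] _ _ _ _] := hD; have [J [cofJ /pcard_injP[f finj]]] := hcount.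
(* [e] inverts [f] on [J], with [j0] as default. *)
have [e he] : exists e : nat -> pw_idx D, forall n j, J j -> f j = n -> e n = j.
  apply: (dep_choice (P := fun n i => forall j, J j -> f j = n -> i = j)) => n.
  have [[i Ji fi]|ni] := pselect (exists2 i, J i & f i = n).
    by exists i => j Jj fj; apply: finj; rewrite ?in_setE// fi.
  by exists j0 => j Jj fj; case: ni; exists j.
pose c := fix c n := if n is m.+1 then projT1 (choice (dir (c m))) (e m) else j0.
have hc n := projT2 (choice (dir (c n))) (e n).
exists c; split=> // [n|j]; first by have [] := hc n.
have [i Ji ji] := cofJ j; exists (f i).+1; apply: trans ji _.
by have [_] := hc (f i); rewrite {1}(he _ i Ji erefl).
Qed.

Lemma closed_chain (c : nat -> pw_idx D) (C : set T) :
  (forall j, exists n, pw_le D j (c n)) ->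
  (forall n, closed (C `&` piece_set (c n))) -> closed C.
Proof.
move=> cof clC; apply/closed_td => j; have [n jn] := cof j.
have := (closed_td (C `&` piece_set (c n))).1 (clC n) j.
apply: td_iff => z; split=> [[Xz [Cz _]]|[Xz Cz]]; split=> //; split=> //.
by apply: piece_set_le jn _ _; exists z.
Qed.

(** The hypothesis bounds [N] only on squares of pieces, which are cofinal among products of two
    pieces by directedness. *)
Lemma closed_prod (N : set (P * P)) x y :
  (forall i, TD [set z : tup M (sum_sort (vs i) (vs i)) |
    [/\ X i (ltup z), X i (rtup z) & N (proj (ltup z), proj (rtup z))]]) ->
  ~ N (x, y) -> exists U V : set T,
    [/\ open U /\ open V, U x, V y & forall a b, U a -> V b -> ~ N (a, b)].
Proof.
move=> tN nN; have [i xi] := piece_set_cover x; have [j yj] := piece_set_cover y.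
have [[_ _ _ dir] _ _ _ _] := hD; have [k [ik jk]] := dir i j.
have [c [c0 cle cof]] := cofinal_chain k.
have [] := @komega_box T (fun n => piece_set (c n)) _ _ _ _ (~` N) x y => //.
- by move=> n; exact: piece_set_compact.
- by move=> n; exact: closed_piece.
- by move=> n; exact: piece_set_le.
- by move=> C; exact: closed_chain.
- by move=> n a b an bn nab; exact: piece_set_box.
- by rewrite c0; exact: piece_set_le ik _ xi.
- by rewrite c0; exact: piece_set_le jk _ yj.
by move=> U [V hUV]; exists U, V.
Qed.

Lemma logic_topology_hausdorff : hausdorff_space T.
Proof.
rewrite open_hausdorff => x y /eqP xy.
have [U [V [[oU oV] Ux Vy UV]]] := @closed_prod [set p | p.1 = p.2] x y
  (fun i => td_kernel i i) xy.
exists (U, V); first by rewrite /= !inE.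
split=> //=; apply/eqP; rewrite -subset0 => z [Uz Vz]; exact: (UV z z).
Qed.

End LogicTopology.

(** * Continuity of the group operations *)

Theorem theorem2p17 (K : Type) (L : language) (M : structure L)
    (hK : strong_limit K) (hL : language_small K L)
    (hsat : saturated K M) (hhom : strongly_homogeneous K M)
    (G : groupType) (D : pw_presentation M G)
    (hG : pw_hyperdefinable_group K D) (hcount : countable_cofinality D)
    (tau : topology_on G) (htau : is_global_logic_topology K D tau) :
  is_topological_group tau.
Proof.
have [A [_ hD hlog hT1]] := htau.
have [A' [_ _ [mulB mulD] [invB invD]]] := hG.
split.
- exact: (logic_topology_hausdorff hK hL hsat hD hlog hT1 hcount).
- move=> [x y] O; rewrite nbhsE => -[O' [oO' O'xy] O'O].
  have [||U [V [[oU oV] Ux Vy UV]]] := @closed_prod _ _ _ hK hL hsat _ _ _ hD _ hlog hT1 hcount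
    [set p : G * G | ~ O' (mul_map p)] x y.
  (* Products of elements of the piece [i] lie in one piece [k], so the trace is the part of the
     graph over the complement of [O'], with its last coordinate projected away. *)
  + move=> i; have [k hk] := mulB (i, i); have [tm _] := mulD ((i, i), k).
    have si := small_idx hD i; have sk := small_idx hD k; have sii := small_sum hK si si.
    have tO := (closed_td hlog hT1 (~` O')).1 (open_closedC oO') k.
    have rr : reindexing (@rtup L M _ _ (sum_sort (idx_sort (pw_pres i)) (idx_sort (pw_pres i)))
      (idx_sort (pw_pres k))) by reindex.
    have t := td_ex hK hL hsat sii sk (td_setI hK hL (small_sum hK sii sk) tm
      (td_preimage hK hL sk rr tO)).
    apply: td_iff t => z; split=> [[w [[[[Xl Xr] Xw] e] [_ nO]]]|[Xl Xr nO]].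
      by split=> //; move: nO; rewrite /graph /= in e; rewrite /proj /= e.
    have [|u _ hu] := hk (mul_map (proj (ltup z), proj (rtup z))).
      exists (proj (ltup z), proj (rtup z)) => //.
      by exists (qproj (pw_pres i) (ltup z), qproj (pw_pres i) (rtup z)).
    have [w Xw ew] := qproj_surj hD u.
    have e : mul_map (proj (ltup z), proj (rtup z)) = proj w.
      by rewrite -hu /proj ew.
    exists w; split; split=> //.
    by move: nO; rewrite /= e.
  + by apply; exact: O'xy.
  apply: filterS (_ : nbhs ((x, y) : top_space tau * top_space tau) (U `*` V)).
    move=> [a b] [Ua Vb]; apply: O'O; apply: contrapT; exact: UV.
  by exists (U, V) => //; split; apply: open_nbhs_nbhs.
(* No rectangles are involved for inversion: the preimage of a closed set has type-definable traces,
   by the same projection of the graph. *)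
apply/continuous_closedP => C clC; apply/(closed_td hlog hT1) => i.
have [k hk] := invB i; have [tm _] := invD (i, k).
have si := small_idx hD i; have sk := small_idx hD k.
have tC := (closed_td hlog hT1 C).1 clC k.
have rr : reindexing (@rtup L M _ _ (idx_sort (pw_pres i)) (idx_sort (pw_pres k))) by reindex.
have t := td_ex hK hL hsat si sk (td_setI hK hL (small_sum hK si sk) tm
  (td_preimage hK hL sk rr tC)).
apply: td_iff t => z; split=> [[w [[[Xz Xw] e] [_ Cw]]]|[Xz Cz]].
  by split=> //; rewrite /graph /= in e; rewrite /proj /preimage /= e.
have [|u _ hu] := hk (inv_map (proj z)).
  by exists (proj z) => //; exists (qproj (pw_pres i) z).
have [w Xw ew] := qproj_surj hD u.
have e : inv_map (proj z) = proj w by rewrite -hu /proj ew.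
exists w; split; split=> //.
by move: Cz; rewrite /preimage /= e.
Qed.
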